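(* Suppose $x_1\in\mathrm{dom}(r)$ satisfies $F(x_1)-\inf_{x\in\mathbb{R}^d}F(x)\le\Delta$ for some $\Delta>0$, that each $g_i$ is $L$-smooth, and that the stagewise algorithm employs SVRG for minimizing $F_k=F^\gamma_{x_k}$ at stage $k$ with step size $\eta_k=0.05/L$, inner iteration number $T_k\ge\max(2,200L/\gamma)$ and number of outer loops $S_k=\lceil\log_2(k)\rceil$. Then with a total of $K$ stages, $$\mathbb{E}\big[\|G_\gamma(x_\tau)\|^2\big]\le\frac{12\gamma\Delta(\alpha+1)}{K},$$ where $\tau\in\{1,\dots,K\}$ is sampled according to $p(\tau=k)=k^\alpha/\sum_{j=1}^Kj^\alpha$ with $\alpha\ge1$.
   Context: Finite-sum problem: $\min_{x\in\mathbb{R}^d}F(x):=g(x)+r(x)-h(x)$ with $g=\frac1{n_1}\sum_{i=1}^{n_1}g_i$, $h=\frac{1}{n_2}\sum_{j=1}^{n_2}h_j$, where $g,h:\mathbb{R}^d\to\mathbb{R}$ are lower-semicontinuous convex and $r:\mathbb{R}^d\to\mathbb{R}\cup\{+\infty\}$ is proper lower-semicontinuous convex. $L$-smooth means differentiable with $L$-Lipschitz gradient. $\|\cdot\|$ is the Euclidean norm. When used as a vector, $\partial h(z)=\frac1{n_2}\sum_j\partial h_j(z)$ denotes a chosen subgradient of $h$ at $z$. For $\gamma>0$, $z\in\mathbb{R}^d$: $$F^{\gamma}_{z}(x)=g(x)+r(x)-\big(h(z)+\partial h(z)^{\top}(x-z)\big)+\tfrac{\gamma}{2}\|x-z\|^2,$$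 $P_\gamma(z)=\arg\min_xF^\gamma_z(x)$, $G_\gamma(z)=\gamma(z-P_\gamma(z))$. Stagewise algorithm: $x_1\in\mathrm{dom}(r)$; for $k=1,\dots,K$, $x_{k+1}$ is the output of SVRG$(F^\gamma_{x_k},x_k,T_k,S_k)$. SVRG$(F^\gamma_{y_1},y_1,T,S)$ with step size $\eta$: $\bar x^{(0)}=y_1$. For $s=1,\dots,S$: set $\bar g_s=\nabla g(\bar x^{(s-1)})-\partial h(y_1)$, $x^{(s)}_0=\bar x^{(s-1)}$; for $t=1,\dots,T$ choose $i_t\in\{1,\dots,n_1\}$ uniformly at random, set $\nabla^{(s)}_t=\nabla g_{i_t}(x^{(s)}_{t-1})-\nabla g_{i_t}(\bar x^{(s-1)})+\bar g_s$ and $$x^{(s)}_t=\arg\min_x\langle\nabla^{(s)}_t,x-x^{(s)}_{t-1}\rangle+\tfrac1{2\eta}\|x-x^{(s)}_{t-1}\|^2+r(x)+\tfrac\gamma2\|x-y_1\|^2;$$ then $\bar x^{(s)}=\frac1T\sum_{t=1}^Tx^{(s)}_t$. Output $\bar x^{(S)}$.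
   Formalization: Each component g_i is additionally assumed convex (the text assumes only that the average g is convex); without this the bound fails, e.g. for g_1 = x²/2, g_2 = −x²/2 with small γ and large T_k. *)

(* Defs.v *)
(* R^d is rendered as 'rV[R]_d, for an arbitrary R : realType. *)
From HB Require Import structures.
From mathcomp Require Import all_boot all_order all_algebra.
From mathcomp Require Import all_classical all_reals all_analysis.

Set Implicit Arguments.
Unset Strict Implicit.
Unset Printing Implicit Defensive.

Import Order.TTheory GRing.Theory Num.Theory.
Import numFieldNormedType.Exports.

Local Open Scope classical_set_scope.
Local Open Scope ring_scope.

Section euclidean.
Context {R : realType} {d : nat}.
Implicit Types (x y z v : 'rV[R]_d) (f : 'rV[R]_d -> R).

Definition dot x y : R := \sum_i x 0 i * y 0 i.

(* The library norm `|x| on 'rV[R]_d is the sup norm, hence this definition.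
   Both norms induce the same topology, so the library notions of
   differentiability and semicontinuity can be used unchanged. *)
Definition enorm x : R := Num.sqrt (dot x x).

Definition grad f x : 'rV[R]_d := \row_i 'D_(delta_mx 0 i) f x.

Definition L_smooth (L : R) f : Prop :=
  (forall x, differentiable f x) /\
  (forall x y, enorm (grad f x - grad f y) <= L * enorm (x - y)).

Definition convex f : Prop := @convex_function R 'rV[R]_d setT f.

Definition lsc f : Prop := lower_semicontinuous (EFin \o f).

Definition subgradient f z v : Prop :=
  forall y, f z + dot v (y - z) <= f y.

Implicit Types r : 'rV[R]_d -> \bar R.

Definition eproper r : Prop :=
  (forall x, r x != -oo%E) /\ (exists x, r x != +oo%E).

(* Meaningful only for functions that never take the value -oo. *)
Definition econvex r : Prop :=
  forall x y (t : R), 0 <= t <= 1 ->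
  (r (t *: x + (1 - t) *: y)%R <= t%:E * r x + (1 - t)%:E * r y)%E.

Definition edom r : set 'rV[R]_d := [set x | (r x < +oo)%E].

(* A global minimizer, or 0 if there is none. *)
Definition argmin r : 'rV[R]_d := xget 0 [set x | forall y, (r x <= r y)%E].

Definition favg n (f : 'I_n -> 'rV[R]_d -> R) x : R :=
  n%:R^-1 * \sum_i f i x.

Definition vavg n (f : 'I_n -> 'rV[R]_d -> 'rV[R]_d) x : 'rV[R]_d :=
  n%:R^-1 *: \sum_i f i x.

End euclidean.

Section dc_problem.
Context {R : realType} {d : nat}.
Variables (g h : 'rV[R]_d -> R) (r : 'rV[R]_d -> \bar R).
(* [dh z] is the chosen subgradient of h at z. *)
Variable dh : 'rV[R]_d -> 'rV[R]_d.
Variable gamma : R.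

Definition dc_obj (x : 'rV[R]_d) : \bar R :=
  ((g x)%:E + r x - (h x)%:E)%E.

Definition surrogate (z x : 'rV[R]_d) : \bar R :=
  ((g x)%:E + r x - (h z + dot (dh z) (x - z))%:E
   + (gamma / 2 * enorm (x - z) ^+ 2)%:E)%E.

Definition prox_point (z : 'rV[R]_d) : 'rV[R]_d := argmin (surrogate z).

Definition prox_grad (z : 'rV[R]_d) : 'rV[R]_d :=
  gamma *: (z - prox_point z).

End dc_problem.

Section svrg.
Context {R : realType} {d n1 : nat}.
Variables (gs : 'I_n1 -> 'rV[R]_d -> R) (r : 'rV[R]_d -> \bar R).
Variable dh : 'rV[R]_d -> 'rV[R]_d.
Variables (gamma eta : R).

Definition svrg_prox (y1 v xprev : 'rV[R]_d) : 'rV[R]_d :=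
  argmin (fun x => (dot v (x - xprev)
                    + (2 * eta)^-1 * enorm (x - xprev) ^+ 2)%:E
                   + r x + (gamma / 2 * enorm (x - y1) ^+ 2)%:E)%E.

(* Iterate t of the inner loop with snapshot [xbar]; [it t] is the component
   drawn at iteration t = 1, 2, ... *)
Fixpoint svrg_inner (y1 xbar : 'rV[R]_d) (it : nat -> 'I_n1) (t : nat) :
    'rV[R]_d :=
  if t is t'.+1 then
    let xprev := svrg_inner y1 xbar it t' in
    let gbar := grad (favg gs) xbar - dh y1 in
    let v := grad (gs (it t)) xprev - grad (gs (it t)) xbar + gbar in
    svrg_prox y1 v xprev
  else xbar.

(* The snapshot after s outer loops of T inner iterations each. *)
Fixpoint svrg (y1 : 'rV[R]_d) (T : nat) (idx : nat -> nat -> 'I_n1) (s : nat) :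
    'rV[R]_d :=
  if s is s'.+1 then
    let xbar := svrg y1 T idx s' in
    T%:R^-1 *: \sum_(1 <= t < T.+1) svrg_inner y1 xbar (idx s) t
  else y1.

(* [stagewise T S idx x1 n] is x_{n+1}, the point after n stages; stage
   k = 1, 2, ... maps x_k to x_{k+1} using T k, S k and the indices idx k. *)
Fixpoint stagewise (T S : nat -> nat) (idx : nat -> nat -> nat -> 'I_n1)
    (x1 : 'rV[R]_d) (n : nat) : 'rV[R]_d :=
  if n is n'.+1 then
    svrg (stagewise T S idx x1 n') (T n) (idx n) (S n)
  else x1.

End svrg.

Definition ceil_log2 (R : realType) (k : nat) : nat :=
  `|Num.ceil (ln k%:R / ln 2 : R)|%N.

Definition power_weight {R : realType} (alpha : R) (K k : nat) : R :=
  k%:R `^ alpha / \sum_(1 <= j < K.+1) j%:R `^ alpha.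

(* The triples (k, s, t) for which the algorithm draws an index. *)
Definition draws (K : nat) (S T : nat -> nat) : pred (nat * nat * nat) :=
  fun j => [&& (1 <= j.1.1 <= K)%N, (1 <= j.1.2 <= S j.1.1)%N
             & (1 <= j.2 <= T j.1.1)%N].

(* The indices [idx k s t], for (k, s, t) in D, are uniform on 'I_n, [tau] has
   law p on {1, ..., K}, and all these discrete variables are mutually
   independent; for discrete variables it is enough to have the product rule
   on events fixing the value of [tau] and of finitely many indices. *)
Record sampling {R : realType} {dO : measure_display} {Omega : measurableType dO}
    (P : probability Omega R) (n K : nat) (D : pred (nat * nat * nat))
    (idx : nat -> nat -> nat -> Omega -> 'I_n) (tau : Omega -> nat)
    (p : nat -> R) : Prop := Sampling {
  idx_event := fun j (i : 'I_n) => [set w | idx j.1.1 j.1.2 j.2 w = i];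
  tau_event := fun m : nat => [set w | tau w = m];
  tau_range : forall w, (1 <= tau w <= K)%N;
  measurable_idx : forall j i, D j -> measurable (idx_event j i);
  measurable_tau : forall m, measurable (tau_event m);
  idx_uniform : forall j i, D j -> P (idx_event j i) = (n%:R^-1)%:E;
  tau_law : forall m, (1 <= m <= K)%N -> P (tau_event m) = (p m)%:E;
  idx_tau_indep : forall (J : seq (nat * nat * nat)) (a : nat * nat * nat -> 'I_n)
      (m : nat), uniq J -> all D J ->
    P (tau_event m `&` [set w | forall j, j \in J -> idx_event j (a j) w])
    = (P (tau_event m) * \prod_(j <- J) P (idx_event j (a j)))%E
}.

(* Main.v *)
(* Fix a stage with center y, let P be its gamma-strongly convex surrogate, u the
   minimizer of P and gap = P - P(u).  In an SVRG inner loop started from the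
   snapshot xb, optimality of the proximal step against u, the descent lemma and
   convexity give
     gap x_t + 10 L |x_t - u|^2
       <= 10 L |x_{t-1} - u|^2 + |e|^2 / (38 L) - <e, x_{t-1} - u>,
   where e is the error of the variance-reduced gradient.  The mean of e over
   the drawn component is zero and, by co-coercivity, the mean of |e|^2 is at
   most 4 L (gap x_{t-1} + gap xb).  Summing over t and using Jensen's
   inequality and |xb - u|^2 <= 2 gap(xb) / gamma, the mean gap is at least
   halved by each outer loop, hence divided by k during stage k.

   As F <= P with equality at y, stage k decreases E F by at least
   (1 - 1/k) E gap(x_k), while |G_gamma(x_k)|^2 <= 2 gamma gap(x_k).  Abel
   summation with the weights k^alpha, the bound gap(x_1) <= Delta for the first
   stage, and sum_k k^alpha >= K^(alpha+1) / (alpha+1) conclude.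

   Expectations are computed as iterated averages over the drawn indices. *)
Require Import Defs.
From HB Require Import structures.
From mathcomp Require Import all_boot all_order all_algebra.
From mathcomp Require Import all_classical all_reals all_analysis.
From mathcomp Require Import measurable_realfun ring lra.

Set Implicit Arguments.
Unset Strict Implicit.
Unset Printing Implicit Defensive.

Import Order.TTheory GRing.Theory Num.Theory.
Import numFieldNormedType.Exports.

Local Open Scope classical_set_scope.
Local Open Scope ring_scope.

(** * Euclidean geometry *)

Section euclidean_space.
Context {R : realType} {d : nat}.
Implicit Types (x y z u v : 'rV[R]_d) (a b : R).

Lemma dotC x y : dot x y = dot y x.
Proof. by apply: eq_bigr => i _; rewrite mulrC. Qed.

Lemma dotDl x y z : dot (x + y) z = dot x z + dot y z.
Proof. by rewrite -big_split; apply: eq_bigr => i _; rewrite mxE mulrDl. Qed.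

Lemma dotZl a x y : dot (a *: x) y = a * dot x y.
Proof. by rewrite mulr_sumr; apply: eq_bigr => i _; rewrite mxE mulrA. Qed.

Lemma dotDr x y z : dot z (x + y) = dot z x + dot z y.
Proof. by rewrite dotC dotDl !(dotC z). Qed.

Lemma dotZr a x y : dot x (a *: y) = a * dot x y.
Proof. by rewrite dotC dotZl dotC. Qed.

Lemma dotNl x y : dot (- x) y = - dot x y.
Proof. by rewrite -scaleN1r dotZl mulN1r. Qed.

Lemma dotNr x y : dot x (- y) = - dot x y.
Proof. by rewrite dotC dotNl dotC. Qed.

Lemma dot0l x : dot 0 x = 0.
Proof. by rewrite -(scale0r 0) dotZl mul0r. Qed.

Lemma dot_suml n (f : 'I_n -> 'rV[R]_d) y :
  dot (\sum_i f i) y = \sum_i dot (f i) y.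
Proof.
apply: (big_morph (fun x => dot x y)); last exact: dot0l.
by move=> u v; rewrite dotDl.
Qed.

Lemma dot_ge0 x : 0 <= dot x x.
Proof. by apply: sumr_ge0 => i _; rewrite -expr2 sqr_ge0. Qed.

Lemma enorm_ge0 x : 0 <= enorm x.
Proof. exact: sqrtr_ge0. Qed.

Lemma sqr_enorm x : enorm x ^+ 2 = dot x x.
Proof. by rewrite sqr_sqrtr// dot_ge0. Qed.

Definition dotE := (dotDl, dotDr, dotNl, dotNr, dotZl, dotZr).

(** Expansion of [|a x - y|^2 >= 0], divided by [2 a]. *)
Lemma young_dot a x y : 0 < a -> dot x y <= a / 2 * dot x x + (2 * a)^-1 * dot y y.
Proof.
move=> a0.
have a2 : 0 <= (2 * a)^-1 by rewrite invr_ge0; lra.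
have := mulr_ge0 a2 (dot_ge0 (a *: x - y)); rewrite !dotE (dotC y x).
move=> H; rewrite -subr_ge0; apply: le_trans H _.
rewrite le_eqVlt; apply/orP; left; apply/eqP; field; lra.
Qed.

Lemma cauchy_schwarz x y : dot x y <= enorm x * enorm y.
Proof.
have [y0|y0] := eqVneq (dot y y) 0.
  have -> : y = 0.
    apply/rowP => i; rewrite mxE; apply/eqP; rewrite -sqrf_eq0 expr2.
    move/eqP: y0; rewrite psumr_eq0 => [/allP/(_ i)|j _];
      rewrite -?expr2 ?sqr_ge0// mem_index_enum.
    exact.
  by rewrite dotC dot0l mulr_ge0// enorm_ge0.
have [|xy] := leP (dot x y) 0.
  by move=> /le_trans; apply; rewrite mulr_ge0// enorm_ge0.
rewrite -ler_sqr ?nnegrE ?mulr_ge0 ?enorm_ge0 ?(ltW xy)// exprMn !sqr_enorm.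
have yy : 0 < dot y y by rewrite lt_def y0 dot_ge0.
(* The residual of [x] after projection onto [y], scaled by [<y, y>] to avoid a division. *)
have := dot_ge0 (dot y y *: x - dot x y *: y); rewrite !dotE (dotC y x).
rewrite [X in 0 <= X -> _](_ : _ = dot y y * (dot x x * dot y y - dot x y ^+ 2)).
  by rewrite pmulr_rge0// subr_ge0.
ring.
Qed.

End euclidean_space.

(** * Smooth convex functions *)

Section smoothness.
Context {R : realType} {d : nat}.
Implicit Types (f : 'rV[R]_d -> R) (x y z u v : 'rV[R]_d) (L t : R).

Lemma derive_grad f x v : differentiable f x -> 'D_v f x = dot (grad f x) v.
Proof.
move=> df; rewrite deriveE// {1}(row_sum_delta v) linear_sum.
by apply: eq_bigr => i _; rewrite mxE deriveE// linearZ/= mulrC.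
Qed.

Lemma is_derive_line f x u t : differentiable f (x + t *: u) ->
  is_derive t 1 (fun s => f (x + s *: u)) (dot (grad f (x + t *: u)) u).
Proof.
move=> df; have D := @diff_derivable _ _ _ f _ u df.
have E : (fun h : R => h^-1 *: (f (h *: u + (x + t *: u)) - f (x + t *: u))) =
    (fun h => h^-1 *: (f (x + (h *: 1 + t) *: u) - f (x + t *: u))).
  apply/funext => h; congr (_ *: (f _ - _)).
  by rewrite scalerDl scaler1 addrCA.
rewrite -(derive_grad u df); split; first by move: D; rewrite /derivable E.
by rewrite /derive E.
Qed.

(** Descent lemma. [phi] is the defect of the bound along the segment from [x] to [y];
    Cauchy-Schwarz and the Lipschitz gradient make its derivative nonpositive. *)
Lemma L_smooth_upper L f x y : L_smooth L f ->
  f y <= f x + dot (grad f x) (y - x) + L / 2 * dot (y - x) (y - x).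
Proof.
move=> [df lip]; set u := y - x.
pose phi t := f (x + t *: u) - t * dot (grad f x) u - L / 2 * dot u u * t ^+ 2.
have dphi t : is_derive t 1 phi
    (dot (grad f (x + t *: u)) u - dot (grad f x) u - L * t * dot u u).
  have := is_derive_line (df (x + t *: u)) => D.
  apply: is_derive_eq; rewrite /= !scaler0 add0r ?scaler1 /GRing.scale/=.
  by field.
have : phi 1 <= phi 0.
  apply: (@ler0_derive1_le_cc R phi 0 1) => //; rewrite ?in_itv/= ?lexx ?ler01//.
  - move=> s; rewrite in_itv/= => /andP[s0 _].
    rewrite derive1E derive_val subr_le0 -dotNl -dotDl.
    apply: le_trans (cauchy_schwarz _ _) _.
    apply: le_trans (ler_wpM2r (enorm_ge0 u) (lip _ _)) _.
    rewrite addrAC subrr add0r -sqr_enorm.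
    have -> : enorm (s *: u) = s * enorm u.
      by rewrite /enorm dotZl dotZr mulrA sqrtrM ?mulr_ge0 ?ltW// -expr2 sqrtr_sqr
        gtr0_norm.
    by rewrite expr2 !mulrA.
  - by apply: derivable_within_continuous => t _; case: (dphi t).
have xu : x + u = y by rewrite /u addrC subrK.
by rewrite /phi scale1r scale0r addr0 xu; lra.
Qed.

Lemma grad_opp f x : differentiable f x -> grad (\- f) x = - grad f x.
Proof.
by move=> df; apply/rowP => i; rewrite !mxE deriveN//; apply: diff_derivable.
Qed.

Lemma L_smoothN L f : L_smooth L f -> L_smooth L (\- f).
Proof.
move=> [df lip]; split => [x|x y]; first exact: differentiableN.
rewrite !grad_opp// -opprD /enorm dotNl dotNr opprK -/(enorm _); exact: lip.
Qed.

Lemma L_smooth_lower L f x y : L_smooth L f ->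
  f x + dot (grad f x) (y - x) - L / 2 * dot (y - x) (y - x) <= f y.
Proof.
move=> sf; have := L_smooth_upper x y (L_smoothN sf).
by rewrite /= grad_opp ?dotNl; [lra | case: sf].
Qed.

(** Lets [t] tend to 0, once a first-order inequality along a segment has been divided by [t]. *)
Lemma ge0_of_vanishing_perturbation (a b : R) :
  (forall t, 0 < t <= 1 -> 0 <= a + b * t) -> 0 <= a.
Proof.
move=> H; rewrite leNgt; apply/negP => a0.
have b1 : 0 < `|b| + 1 by rewrite ltr_wpDl.
(* Small enough that [|b| t <= - a / 2], which would make [a + b t] negative. *)
pose t := Num.min 1 (- a / (2 * (`|b| + 1))).
have tb : t <= - a / (2 * (`|b| + 1)) by rewrite ge_min lexx orbT.
have t0 : 0 < t by rewrite lt_min ltr01 divr_gt0//; lra.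
have /H : 0 < t <= 1 by rewrite t0 ge_min lexx.
have := ler_wpM2l (ltW b1) tb.
have -> : (`|b| + 1) * (- a / (2 * (`|b| + 1))) = - a / 2 by field; lra.
have := ler_wpM2r (ltW t0) (ler_norm b).
by lra.
Qed.

Lemma convexP f x y t : convex f -> 0 <= t <= 1 ->
  f (t *: x + (1 - t) *: y) <= t * f x + (1 - t) * f y.
Proof.
move=> cf t01; have := cf (Itv01 (proj1 (andP t01)) (proj2 (andP t01))) x y.
by apply; rewrite inE.
Qed.

(** On the segment from [x] to [y], convexity bounds [f] from above and smoothness bounds it from
    below up to order [t^2]; divide by [t] and let it vanish. *)
Lemma convex_lower L f x y : convex f -> L_smooth L f ->
  f x + dot (grad f x) (y - x) <= f y.
Proof.
move=> cf sf; rewrite -subr_ge0.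
apply: (@ge0_of_vanishing_perturbation _ (L / 2 * dot (y - x) (y - x))).
move=> t /andP[t0 t1].
have := L_smooth_lower x (x + t *: (y - x)) sf.
rewrite [x + _ - x]addrAC subrr add0r dotZr dotZl dotZr => H.
have := @convexP f y x t cf; rewrite ltW//= t1 => /(_ isT).
rewrite (_ : t *: y + _ = x + t *: (y - x)); last first.
  by rewrite scalerBr scalerBl scale1r addrCA.
move=> H'; rewrite -(pmulr_rge0 _ t0); nra.
Qed.

(* Descent from [y] by the gradient step of length 1/L of the tilted function
   [f - <grad f x, .>], whose minimizer is [x]. *)
Lemma cocoercive L f x y : 0 < L -> convex f -> L_smooth L f ->
  f x + dot (grad f x) (y - x)
    + (2 * L)^-1 * dot (grad f y - grad f x) (grad f y - grad f x) <= f y.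
Proof.
move=> L0 cf sf; set w := grad f y - grad f x; pose z := y - L^-1 *: w.
have H1 := L_smooth_upper y z sf; have H2 := convex_lower x z cf sf.
have zy : z - y = - (L^-1 *: w) by rewrite /z addrAC subrr add0r.
have zx : z - x = (y - x) - L^-1 *: w by rewrite /z addrAC.
have ww : dot w w = dot (grad f y) w - dot (grad f x) w.
  by rewrite {1}/w dotDl dotNl.
move: H1 H2; rewrite {}zx {}zy (dotDr (y - x)) !dotNr dotNl opprK dotZl !dotZr.
rewrite invfM ww; move: (dot (grad f y) w) (dot (grad f x) w) => a b.
move: (dot _ (y - x)) => c H1 H2.
have : L / 2 * (L^-1 * (L^-1 * (a - b))) = L^-1 / 2 * (a - b).
  by field; rewrite gt_eqF.
lra.
Qed.

End smoothness.

(** * Existence of minimizers *)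

Lemma seq_argmin (T : eqType) disp (O : orderType disp) (F : T -> O) (s : seq T) (x : T) :
  x \in s -> exists2 y, y \in s & forall z, z \in s -> (F y <= F z)%O.
Proof.
elim: s x => // a s IH x _; case: s IH => [_|b s IH].
  by exists a; rewrite ?mem_head// => z; rewrite inE => /eqP ->.
have [y ys ymin] := IH b (mem_head _ _).
have [ay|/ltW ya] := leP (F a) (F y).
  exists a; rewrite ?mem_head// => z; rewrite inE => /orP[/eqP -> //|zs].
  exact: le_trans ay (ymin _ zs).
exists y; first by rewrite inE ys orbT.
by move=> z; rewrite inE => /orP[/eqP -> //|]; exact: ymin.
Qed.

Section minimizers.
Context {R : realType} {d : nat}.
Implicit Types (f r : 'rV[R]_d -> \bar R) (x y z : 'rV[R]_d).

Lemma lscD_continuous f (c : 'rV[R]_d -> R) : lower_semicontinuous f ->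
  continuous c -> lower_semicontinuous (fun x => f x + (c x)%:E)%E.
Proof.
(* When [f x] is finite, [e] is half the slack: [f] and [c] may each lose [e]. *)
move=> lf cc x a; case fx: (f x) => [s| |] //= ax.
- rewrite -EFinD lte_fin in ax; pose e := (s + c x - a) / 2.
  have e0 : 0 < e by rewrite /e; lra.
  have [V nV HV] := lf x (s - e) ltac:(by rewrite fx lte_fin; lra).
  have nW : nbhs x [set y | `|c x - c y| < e].
    by have /cvgrPdist_lt/(_ e e0) := cc x.
  exists (V `&` [set y | `|c x - c y| < e]); first exact: filterI.
  move=> y [/HV Vy /=]; rewrite ltr_norml => /andP[_ cy].
  rewrite -(subrK (c y) a) EFinD lte_leD//; apply: le_lt_trans Vy.
  by rewrite lee_fin /e; rewrite /e in cy; lra.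
- have [V nV HV] := lf x (a - c x + 1) ltac:(by rewrite fx ltry).
  have nW : nbhs x [set y | `|c x - c y| < 1].
    by have /cvgrPdist_lt/(_ 1 ltr01) := cc x.
  exists (V `&` [set y | `|c x - c y| < 1]); first exact: filterI.
  move=> y [/HV Vy /=]; rewrite ltr_norml => /andP[_ cy].
  rewrite -(subrK (c y) a) EFinD lte_leD//; apply: le_lt_trans Vy.
  by rewrite lee_fin; lra.
Qed.

Lemma sup_norm_le_enorm x : `|x| <= enorm x.
Proof.
rewrite [leLHS]/Num.norm/= mx_normrE; apply: bigmax_le => [|[i j] _].
  exact: enorm_ge0.
rewrite /= (ord1 i) -sqrtr_sqr ler_wsqrtr// /dot (bigD1 j)//= expr2 lerDl.
by apply: sumr_ge0 => k _; rewrite -expr2 sqr_ge0.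
Qed.

(** Quadratic growth makes a sublevel set compact. If it held no minimizer, the open sets
    [f y < f x] would cover it, but in a finite subcover the [y] of least value is itself uncovered.
    Hence [argmin] does not fall back on its default. *)
Lemma argmin_le f x0 z (m a : R) : lower_semicontinuous f -> (f x0 < +oo)%E ->
    0 < a -> (forall x, (m + a * enorm (x - z) ^+ 2)%:E <= f x)%E ->
  forall x, (f (argmin f) <= f x)%E.
Proof.
move=> lf fx0 a0 coer.
suff [y Hy] : exists y, forall x, (f y <= f x)%E.
  by rewrite /argmin; case: xgetP => [w _ Hw //|/(_ y)].
have [M fM] : exists M, f x0 = M%:E.
  exists (fine (f x0)); rewrite fineK// fin_numElt fx0 andbT.
  by apply: lt_le_trans (coer x0); rewrite ltNyr.
pose A := [set x | (f x <= M%:E)%E].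
have fA y : A y -> f y = (fine (f y))%:E.
  move=> Ay; rewrite fineK// fin_numElt (le_lt_trans Ay (ltry _)) andbT.
  by apply: lt_le_trans (coer y); rewrite ltNyr.
have cA : compact A.
  apply: bounded_closed_compact.
    exists (`|z| + (1 + (M - m) / a)); split; first exact: num_real.
    move=> B HB x /= Ax; apply: le_trans (ltW HB).
    rewrite -[x in `|x|](subrK z) addrC (le_trans (ler_normD _ _))// lerD2l.
    apply: le_trans (sup_norm_le_enorm _) _.
    have := le_trans (coer x) Ax; rewrite lee_fin => H.
    have : enorm (x - z) ^+ 2 <= (M - m) / a by rewrite ler_pdivlMr//; lra.
    (* [2 e <= 1 + e^2] turns the bound on the squared distance into one on the distance. *)
    have := sqr_ge0 (enorm (x - z) - 1); nra.
  have -> : A = ~` [set x | (M%:E < f x)%E].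
    by apply/seteqP; split => x /=; rewrite /A/= leNgt => /negP.
  by apply: open_closedC; move/lower_semicontinuousP: lf.
have [|nmin] := pselect (exists2 y, A y & forall x, A x -> (f y <= f x)%E).
  move=> [y Ay ymin]; exists y => x.
  have [Ax|Ax] := pselect (A x); first exact: ymin.
  by apply: (le_trans Ay); move/negP: Ax; rewrite -ltNge => /ltW.
move: cA; rewrite compact_cover.
move=> /(_ _ A (fun y => [set x | (f y < f x)%E])) [y Ay||D DA AD].
- by rewrite (fA _ Ay); move/lower_semicontinuousP: lf.
- move=> x Ax; apply: contrapT => nx; apply: nmin; exists x => // y Ay.
  by rewrite leNgt; apply/negP => yx; apply: nx; exists y.
have /AD[y Dy _] : A x0 by rewrite /A/= fM.
have [w Dw wmin] := @seq_argmin _ _ _ f (finmap.enum_fset D) y Dy.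
have /AD[u Du uw] : A w by move/DA: Dw; rewrite inE.
by move: uw; rewrite /= ltNge wmin.
Qed.

End minimizers.

(** * Finite averages *)

(** Written like [favg], so that [favg gs x] is by conversion the mean of the [gs i x]. *)
Definition mean {R : realType} n (F : 'I_n -> R) : R := n%:R^-1 * \sum_i F i.

Section mean.
Context {R : realType} {n : nat}.
Implicit Types F G : 'I_n -> R.

Lemma ler_mean F G : (forall i, F i <= G i) -> mean F <= mean G.
Proof. by move=> FG; rewrite ler_wpM2l ?invr_ge0// ler_sum. Qed.

Lemma meanD F G : mean (fun i => F i + G i) = mean F + mean G.
Proof. by rewrite /mean big_split mulrDr. Qed.

Lemma meanZ a F : mean (fun i => a * F i) = a * mean F.
Proof. by rewrite /mean -mulr_sumr mulrCA. Qed.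

Lemma mean_cst (c : R) : (0 < n)%N -> mean (fun _ : 'I_n => c) = c.
Proof.
move=> n0; rewrite /mean sumr_const card_ord -(mulr_natl c) mulrA.
by rewrite mulVf ?mul1r// pnatr_eq0 -lt0n.
Qed.

End mean.

Section vector_mean.
Context {R : realType} {d n : nat}.

Lemma dot_mean (V : 'I_n -> 'rV[R]_d) u :
  dot (n%:R^-1 *: \sum_i V i) u = mean (fun i => dot (V i) u).
Proof. by rewrite dotZl dot_suml. Qed.

(* The second moment decomposes as variance plus squared mean. *)
Lemma mean_variance_le (V : 'I_n -> 'rV[R]_d) (m := n%:R^-1 *: \sum_i V i) :
  (0 < n)%N ->
  mean (fun i => dot (V i - m) (V i - m)) <= mean (fun i => dot (V i) (V i)).
Proof.
move=> n0.
have -> : (fun i => dot (V i - m) (V i - m)) =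
    (fun i => dot (V i) (V i) + ((- 2) * dot (V i) m + dot m m)).
  apply/funext => i; rewrite !dotDl !dotDr !dotNl !dotNr (dotC m); ring.
rewrite meanD (meanD (fun i => - 2 * dot (V i) m)) meanZ mean_cst// -dot_mean -/m.
by have := dot_ge0 m; lra.
Qed.

Lemma grad_favg (gs : 'I_n -> 'rV[R]_d -> R) x :
  (forall i, differentiable (gs i) x) ->
  grad (favg gs) x = n%:R^-1 *: \sum_i grad (gs i) x.
Proof.
move=> dgs; apply/rowP => j; rewrite !mxE summxE.
have -> : favg gs = n%:R^-1 \*: \sum_i gs i.
  by apply/funext => z; rewrite /favg /= fct_sumE.
rewrite deriveZ; last by apply: derivable_sum => i; apply: diff_derivable.
rewrite derive_sum; last by move=> i; apply: diff_derivable.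
by congr (_ * _); apply: eq_bigr => i _; rewrite mxE.
Qed.

End vector_mean.

Section finite_sum.
Context {R : realType} {d n : nat}.
Variables (gs : 'I_n -> 'rV[R]_d -> R) (L : R).
Hypotheses (n_gt0 : (0 < n)%N) (L_gt0 : 0 < L).
Hypotheses (gs_convex : forall i, convex (gs i)).
Hypotheses (gs_smooth : forall i, L_smooth L (gs i)).
Local Notation g := (favg gs).
Implicit Types x y u v : 'rV[R]_d.

Lemma dot_grad_favg x u : dot (grad g x) u = mean (fun i => dot (grad (gs i) x) u).
Proof.
by rewrite grad_favg ?dot_mean// => i; case: (gs_smooth i).
Qed.

Lemma favg_upper x y :
  g y <= g x + dot (grad g x) (y - x) + L / 2 * dot (y - x) (y - x).
Proof.
rewrite dot_grad_favg -(mean_cst (L / 2 * _) n_gt0) -!meanD.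
by apply: ler_mean => i; apply: L_smooth_upper.
Qed.

Lemma favg_lower x y : g x + dot (grad g x) (y - x) <= g y.
Proof.
rewrite dot_grad_favg -!meanD.
by apply: ler_mean => i; apply: convex_lower (gs_smooth i).
Qed.

(** Averaged co-coercivity: the Bregman divergence of [g] controls the spread of the component
    gradients. *)
Lemma favg_cocoercive x y :
  mean (fun i => dot (grad (gs i) y - grad (gs i) x) (grad (gs i) y - grad (gs i) x))
  <= 2 * L * (g y - g x - dot (grad g x) (y - x)).
Proof.
rewrite mulrC -ler_pdivrMr ?mulr_gt0// mulrC -meanZ lerBrDr lerBrDr.
rewrite dot_grad_favg -!meanD.
apply: ler_mean => i.
by have := cocoercive x y L_gt0 (gs_convex i) (gs_smooth i); lra.
Qed.

Lemma favg_continuous : continuous g.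
Proof.
move=> x; have -> : g = (fun z => n%:R^-1 * (\sum_i gs i) z).
  by apply/funext => z; rewrite /favg fct_sumE.
have cs : {for x, continuous (\sum_i gs i)}.
  apply: differentiable_continuous; apply: differentiable_sum => i.
  by case: (gs_smooth i).
exact: cvgMl_tmp cs.
Qed.

End finite_sum.

(** * Convex regularizers *)

Section dot_continuity.
Context {R : realType} {d : nat}.

Lemma continuous_dot (p q : 'rV[R]_d -> 'rV[R]_d) : continuous p -> continuous q ->
  continuous (fun x => dot (p x) (q x)).
Proof.
move=> cp cq; rewrite /dot; apply: continuous_big; first exact: add_continuous.
move=> i _; have cc (u : 'rV[R]_d -> 'rV[R]_d) : continuous u ->
    continuous (fun x : 'rV[R]_d => u x 0 i : R).
  move=> cu x; apply: (@continuous_comp _ _ _ u (fun M : 'rV[R]_d => M 0 i) x (cu x)).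
  exact: coord_continuous.
by move=> x; exact: (cvgM (cc p cp x) (cc q cq x)).
Qed.

End dot_continuity.

Section regularizer.
Context {R : realType} {d : nat}.
Variable r : 'rV[R]_d -> \bar R.
Hypotheses (r_proper : eproper r) (r_convex : econvex r).
Implicit Types x y z u : 'rV[R]_d.

Lemma edom_fineK x : edom r x -> (fine (r x))%:E = r x.
Proof. by move=> rx; rewrite fineK// fin_numE (proj1 r_proper) lt_eqF. Qed.

Lemma edom_segment x y (t : R) : 0 <= t <= 1 -> edom r x -> edom r y ->
  edom r (t *: x + (1 - t) *: y) /\
  fine (r (t *: x + (1 - t) *: y)) <= t * fine (r x) + (1 - t) * fine (r y).
Proof.
move=> t01 rx ry; have H := r_convex x y t01.
rewrite -(edom_fineK rx) -(edom_fineK ry) -!EFinM -EFinD in H.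
have D : edom r (t *: x + (1 - t) *: y) by apply: le_lt_trans H (ltry _).
by split => //; rewrite -lee_fin (edom_fineK D).
Qed.

Lemma edom_step x u (t : R) : 0 <= t <= 1 -> edom r x -> edom r u ->
  edom r (u + t *: (x - u)) /\
  fine (r (u + t *: (x - u))) <= fine (r u) + t * (fine (r x) - fine (r u)).
Proof.
move=> t01 rx ru; have [] := edom_segment t01 rx ru.
rewrite (_ : t *: x + _ = u + t *: (x - u)); last first.
  by rewrite scalerBr scalerBl scale1r addrCA.
by move=> ? ?; split => //; lra.
Qed.

(* First-order optimality of a minimizer [u] of [s + r + b |. - y|^2], where the
   smooth part [s] has slope at most [e] at [u] towards [x]; the strong
   convexity of the quadratic supplies the left-hand side. *)
Lemma prox_optimality (b e c : R) (s : 'rV[R]_d -> R) y u x :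
    edom r u -> edom r x ->
    (forall w, edom r w -> s u + fine (r u) + b * dot (u - y) (u - y) <=
      s w + fine (r w) + b * dot (w - y) (w - y)) ->
    (forall t, 0 < t <= 1 -> s (u + t *: (x - u)) <= s u + t * e + t ^+ 2 * c) ->
  b * dot (x - u) (x - u) <= e + fine (r x) - fine (r u)
    + b * dot (x - y) (x - y) - b * dot (u - y) (u - y).
Proof.
move=> ru rx umin slope; rewrite -subr_ge0.
apply: (@ge0_of_vanishing_perturbation _ _ (c + b * dot (x - u) (x - u))) => t t01.
have /andP[t0 t1] := t01.
have [|rw rle] := @edom_step x u t _ rx ru; first by rewrite ltW.
have := umin _ rw; have := slope _ t01.
have -> : dot (u + t *: (x - u) - y) (u + t *: (x - u) - y) =
   (1 - t) * dot (u - y) (u - y) + t * dot (x - y) (x - y)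
   - t * (1 - t) * dot (x - u) (x - u).
  have -> : u + t *: (x - u) - y = (u - y) + t *: (x - u) by rewrite addrAC.
  have -> : x - y = (u - y) + (x - u) by rewrite [RHS]addrC subrKA.
  by move: (u - y) (x - u) => p q; rewrite !(dotDl, dotDr, dotZl, dotZr) (dotC q p); ring.
move=> H1 H2; rewrite -(pmulr_rge0 _ t0); lra.
Qed.

End regularizer.

(** * Iterated averages *)

Section iterated_mean.
Context {R : realType} {n : nat} {I : eqType}.
Implicit Types (a : I -> 'I_n) (J : seq I) (Phi Psi : (I -> 'I_n) -> R).

Definition upd a j i : I -> 'I_n := fun k => if k == j then i else a k.

Lemma upd_same a j i : upd a j i j = i.
Proof. by rewrite /upd eqxx. Qed.

(** Plays the role of the conditional expectation over the draws in [J], the table [a] fixing all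
    others; the head of [J] is averaged outermost. *)
Fixpoint iter_mean J Phi a : R :=
  if J is j :: J' then mean (fun i => iter_mean J' Phi (upd a j i)) else Phi a.

Lemma iter_mean_cat J1 J2 Phi a :
  iter_mean (J1 ++ J2) Phi a = iter_mean J1 (iter_mean J2 Phi) a.
Proof. by elim: J1 a => //= j J IH a; congr mean; apply/funext => i. Qed.

(** Only tables agreeing with [a] off [J] matter: this keeps earlier draws frozen while later ones
    are averaged. *)
Lemma ler_iter_mean J Phi Psi a :
  (forall a', (forall j, j \notin J -> a' j = a j) -> Phi a' <= Psi a') ->
  iter_mean J Phi a <= iter_mean J Psi a.
Proof.
elim: J a => /= [|j J IH] a H; first exact: H.
apply: ler_mean => i; apply: IH => a' Ha'; apply: H => k.
by rewrite inE negb_or => /andP[kj kJ]; rewrite Ha'// /upd (negbTE kj).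
Qed.

Lemma iter_meanD J Phi Psi a :
  iter_mean J (fun a => Phi a + Psi a) a = iter_mean J Phi a + iter_mean J Psi a.
Proof.
elim: J a => //= j J IH a; rewrite -meanD; congr mean.
by apply/funext => i; exact: IH.
Qed.

Lemma iter_meanZ J c Phi a :
  iter_mean J (fun a => c * Phi a) a = c * iter_mean J Phi a.
Proof.
elim: J a => //= j J IH a; rewrite -meanZ; congr mean.
by apply/funext => i; exact: IH.
Qed.

Lemma iter_mean_cst J c a : (0 < n)%N -> iter_mean J (fun=> c) a = c.
Proof.
move=> n0; elim: J a => //= j J IH a; rewrite -[RHS](mean_cst c n0); congr mean.
by apply/funext => i; exact: IH.
Qed.

End iterated_mean.

Lemma sqdist_le {R : realType} {d : nat} (a b c : 'rV[R]_d) :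
  dot (a - b) (a - b) <= 2 * dot (a - c) (a - c) + 2 * dot (b - c) (b - c).
Proof.
have -> : a - b = (a - c) - (b - c) by rewrite opprB subrKA.
have := dot_ge0 ((a - c) + (b - c)); move: (a - c) (b - c) => p q.
rewrite !(dotDl, dotDr, dotNl, dotNr) (dotC q p); lra.
Qed.

(* The average over no points is junk, hence [0 < T]. *)
Lemma jensen_average {R : realType} {V : lmodType R} (C : set V) (phi : V -> R)
    (x : nat -> V) (T : nat) :
  (forall u v t, C u -> C v -> 0 <= t <= 1 -> C (t *: u + (1 - t) *: v) /\
    phi (t *: u + (1 - t) *: v) <= t * phi u + (1 - t) * phi v) ->
  (forall t, C (x t)) -> (0 < T)%N ->
  C (T%:R^-1 *: \sum_(1 <= t < T.+1) x t) /\
  phi (T%:R^-1 *: \sum_(1 <= t < T.+1) x t)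
    <= T%:R^-1 * \sum_(1 <= t < T.+1) phi (x t).
Proof.
move=> cv Cx; case: T => // T _; elim: T => [|T [IHC IH]].
  by rewrite !big_nat1 invr1 scale1r mul1r.
rewrite big_nat_recr//= (big_nat_recr T.+2)//=.
set X := \sum_(_ <= _ < _) x _ in IHC IH *; set Y := \sum_(_ <= _ < _) phi _ in IH *.
have t01 : 0 <= (T.+2%:R^-1 : R) <= 1.
  by rewrite invr_ge0 ler0n invf_le1 ?ltr0n// ler1n.
have E : 1 - T.+2%:R^-1 = T.+2%:R^-1 * T.+1%:R :> R.
  by rewrite -[T.+2]addn1 natrD; field; rewrite gt_eqF// ltr_wpDl.
(* The new average is a convex combination of the new point, with weight [1 / (T + 2)], and the
   previous average. *)
have [] := cv _ _ _ (Cx T.+2) IHC t01.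
have -> : T.+2%:R^-1 *: x T.+2 + (1 - T.+2%:R^-1) *: (T.+1%:R^-1 *: X) =
    T.+2%:R^-1 *: (X + x T.+2).
  by rewrite scalerA E mulfK ?pnatr_eq0// -scalerDr addrC.
move=> ? H; split => //; apply: (le_trans H).
have E' : (1 - T.+2%:R^-1) * (T.+1%:R^-1 * Y) = T.+2%:R^-1 * Y.
  by rewrite mulrA E mulfK ?pnatr_eq0.
have i0 : 0 <= 1 - T.+2%:R^-1 :> R by rewrite subr_ge0; case/andP: t01.
by have := ler_wpM2l i0 IH; rewrite E' mulrDr => H'; rewrite addrC lerD2r.
Qed.

(** * Stages of the algorithm *)

Section stage.
Context {R : realType} {d n : nat}.
Variables (gs : 'I_n -> 'rV[R]_d -> R) (h : 'rV[R]_d -> R) (r : 'rV[R]_d -> \bar R).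
Variables (dh : 'rV[R]_d -> 'rV[R]_d) (L gamma m : R) (x0 : 'rV[R]_d).
Hypotheses (n_gt0 : (0 < n)%N) (L_gt0 : 0 < L) (gamma_gt0 : 0 < gamma).
Hypotheses (gs_convex : forall i, convex (gs i)).
Hypotheses (gs_smooth : forall i, L_smooth L (gs i)).
Hypotheses (r_proper : eproper r) (r_lsc : lower_semicontinuous r).
Hypotheses (r_convex : econvex r).
Hypothesis (dh_subgradient : forall z, subgradient h z (dh z)).
Hypothesis x0_dom : edom r x0.
Local Notation g := (favg gs).
(** With [dh] a subgradient, the lower bound [m] gives every subproblem quadratic growth, and [x0]
    makes its domain nonempty; so minimizers exist. *)
Hypothesis F_ge : forall x, edom r x -> m <= g x + fine (r x) - h x.
Implicit Types x y z u v : 'rV[R]_d.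

(** Real-valued form of [surrogate], faithful only on the domain of [r]. *)
Definition stage_obj y x : R :=
  g x + fine (r x) - (h y + dot (dh y) (x - y)) + gamma / 2 * dot (x - y) (x - y).

Lemma surrogateE y x : edom r x ->
  surrogate g h r dh gamma y x = (stage_obj y x)%:E.
Proof. by move=> rx; rewrite /surrogate -(edom_fineK r_proper rx) sqr_enorm. Qed.

Lemma not_edom x : ~ edom r x -> r x = +oo%E.
Proof. by move=> nx; apply/eqP; rewrite -leye_eq leNgt; apply/negP. Qed.

Lemma continuous_shift y : continuous (fun x : 'rV[R]_d => x - y : 'rV[R]_d).
Proof. by move=> x; exact: differentiable_continuous. Qed.

Lemma continuous_sqdist y : continuous (fun x => enorm (x - y) ^+ 2).
Proof.
under [X in continuous X]funext do rewrite sqr_enorm.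
by apply: continuous_dot; exact: continuous_shift.
Qed.

Lemma continuous_dot_shift v y : continuous (fun x => dot v (x - y)).
Proof. by apply: continuous_dot; [exact: cst_continuous | exact: continuous_shift]. Qed.

Lemma surrogate_lsc y : lower_semicontinuous (surrogate g h r dh gamma y).
Proof.
have -> : surrogate g h r dh gamma y =
    (fun x => r x + (g x - (h y + dot (dh y) (x - y))
      + gamma / 2 * enorm (x - y) ^+ 2)%:E)%E.
  apply/funext => x; rewrite /surrogate.
  by case: (r x) => [s| |] //=; rewrite -!EFinD; congr EFin; ring.
apply: lscD_continuous => // x.
have c : h y + dot (dh y) (z - y) @[z --> x] --> h y + dot (dh y) (x - y).
  exact: (cvgD (cvg_cst (h y)) (@continuous_dot_shift (dh y) y x)).
exact: (cvgD (cvgB (@favg_continuous _ _ _ _ _ gs_smooth x) c)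
  (cvgMl_tmp (@continuous_sqdist y x))).
Qed.

Lemma stage_obj_ge y x : edom r x ->
  m + gamma / 2 * dot (x - y) (x - y) <= stage_obj y x.
Proof.
by move=> rx; have := F_ge rx; have := dh_subgradient y x; rewrite /stage_obj; lra.
Qed.

Lemma surrogate_min y x :
  (surrogate g h r dh gamma y (prox_point g h r dh gamma y)
    <= surrogate g h r dh gamma y x)%E.
Proof.
have g2 : 0 < gamma / 2 by rewrite divr_gt0.
apply: (@argmin_le _ _ (surrogate g h r dh gamma y) x0 y m (gamma / 2)) => //.
- exact: surrogate_lsc.
- by rewrite surrogateE// ltry.
move=> z; have [rz|/not_edom rz] := pselect (edom r z).
  by rewrite surrogateE// lee_fin sqr_enorm stage_obj_ge.
by rewrite /surrogate rz /= leey.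
Qed.

Lemma prox_point_dom y : edom r (prox_point g h r dh gamma y).
Proof.
apply: contrapT => /not_edom E; have := surrogate_min y x0.
by rewrite (surrogateE _ x0_dom) {1}/surrogate E.
Qed.

Local Notation prox := (prox_point g h r dh gamma).

Lemma prox_point_le y x : edom r x -> stage_obj y (prox y) <= stage_obj y x.
Proof.
move=> rx; rewrite -lee_fin -!surrogateE//; first exact: surrogate_min.
exact: prox_point_dom.
Qed.

(** The Bregman divergence of [g] is kept next to the quadratic: the quadratic later bounds
    distances to [u], the divergence bounds gradient variances. *)
Lemma stage_obj_growth y x (u := prox y) : edom r x ->
  g x - g u - dot (grad g u) (x - u) + gamma / 2 * dot (x - u) (x - u) <=
  stage_obj y x - stage_obj y u.
Proof.
move=> rx; have ru : edom r u by exact: prox_point_dom.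
pose s z := g z - (h y + dot (dh y) (z - y)).
have := @prox_optimality _ _ r r_proper r_convex (gamma / 2)
  (dot (grad g u - dh y) (x - u)) (L / 2 * dot (x - u) (x - u)) s y u x ru rx.
have E : dot (dh y) (x - u) = dot (dh y) (x - y) - dot (dh y) (u - y).
  by rewrite -dotNr -dotDr opprB subrKA.
rewrite (dotDl (grad g u)) (dotNl (dh y)) E.
move=> H; suff : gamma / 2 * dot (x - u) (x - u) <=
  dot (grad g u) (x - u) - (dot (dh y) (x - y) - dot (dh y) (u - y)) +
  fine (r x) - fine (r u) + gamma / 2 * dot (x - y) (x - y) -
  gamma / 2 * dot (u - y) (u - y) by rewrite /stage_obj; lra.
apply: H => [w rw|t t01].
  by have := prox_point_le y rw; rewrite -/u /stage_obj /s; lra.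
have := favg_upper n_gt0 gs_smooth u (u + t *: (x - u)).
rewrite /s [u + _ - u]addrAC subrr add0r [u + _ - y]addrAC (dotDr (u - y)) !dotZr dotZl.
by rewrite E; lra.
Qed.

Local Notation eta := (5 / 100 / L).

(** Source of the factor [10 L] in all distance terms below. *)
Lemma half_inv_eta : (2 * eta)^-1 = 10 * L.
Proof. by field; rewrite gt_eqF. Qed.

(** * One proximal step with an arbitrary gradient estimate [v] *)

Section prox_step.
Variables (y v xp : 'rV[R]_d).
Local Notation x' := (svrg_prox r gamma eta y v xp).

Let q x : \bar R := ((dot v (x - xp) + (2 * eta)^-1 * enorm (x - xp) ^+ 2)%:E
  + r x + (gamma / 2 * enorm (x - y) ^+ 2)%:E)%E.

Let qE x : edom r x -> q x = (dot v (x - xp) + 10 * L * dot (x - xp) (x - xp)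
  + fine (r x) + gamma / 2 * dot (x - y) (x - y))%:E.
Proof.
by move=> rx; rewrite /q half_inv_eta !sqr_enorm -(edom_fineK r_proper rx).
Qed.

Let q_lsc : lower_semicontinuous q.
Proof.
have -> : q = (fun x => r x + (dot v (x - xp) + (2 * eta)^-1 * enorm (x - xp) ^+ 2
    + gamma / 2 * enorm (x - y) ^+ 2)%:E)%E.
  apply/funext => x; rewrite /q.
  by case: (r x) => [s| |] //=; rewrite -!EFinD; congr EFin; ring.
apply: lscD_continuous => // x; exact: (cvgD (cvgD (@continuous_dot_shift v xp x)
  (cvgMl_tmp (@continuous_sqdist xp x))) (cvgMl_tmp (@continuous_sqdist y x))).
Qed.

(* [r >= m - g + h] is bounded below by a quadratic of curvature L, which the
   term of curvature 20 L dominates. *)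
Let q_min x : (q x' <= q x)%E.
Proof.
(* [w] gathers the linear terms at [xp]. Young's inequality absorbs [<w, z - xp>] at the cost of
   [L/2 |z - xp|^2] and of the last term of [c]. *)
pose w := dh xp - grad g xp + v.
pose c := m + h xp - g xp - (2 * L)^-1 * dot w w.
apply: (@argmin_le _ _ q x0 xp c L) => //.
  by rewrite qE// ltry.
move=> z; have [rz|/not_edom rz] := pselect (edom r z); last first.
  by rewrite /q rz /= leey.
rewrite qE// lee_fin sqr_enorm /c.
have H1 := F_ge rz; have H2 := dh_subgradient xp z.
have H3 := favg_upper n_gt0 gs_smooth xp z.
have := young_dot (- (z - xp)) w L_gt0.
have -> : dot (- (z - xp)) w =
    - (dot (dh xp) (z - xp) - dot (grad g xp) (z - xp) + dot v (z - xp)).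
  by rewrite dotNl (dotC _ w) /w !(dotDl, dotNl).
rewrite dotNl dotNr opprK.
have H4 := dot_ge0 (z - y); have H5 := dot_ge0 (z - xp).
have H6 := mulr_ge0 (ltW gamma_gt0) H4; have H7 := mulr_ge0 (ltW L_gt0) H5.
lra.
Qed.

Lemma svrg_prox_dom : edom r x'.
Proof.
apply: contrapT => /not_edom E; have := q_min x0.
by rewrite (qE x0_dom) {1}/q E.
Qed.

(** Three-point form: the slope [20 L <x' - xp, x - x'>] of the proximal term becomes a difference
    of squared distances. *)
Lemma svrg_prox_optimality x : edom r x ->
  0 <= dot v (x - x') + 10 * L * (dot (x - xp) (x - xp) - dot (x' - xp) (x' - xp)
    - dot (x - x') (x - x')) + fine (r x) - fine (r x')
    + gamma / 2 * (dot (x - y) (x - y) - dot (x' - y) (x' - y)).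
Proof.
move=> rx; have rx' := svrg_prox_dom.
pose s z := dot v (z - xp) + 10 * L * dot (z - xp) (z - xp).
have := @prox_optimality _ _ r r_proper r_convex (gamma / 2)
  (dot v (x - x') + 20 * L * dot (x' - xp) (x - x')) (10 * L * dot (x - x') (x - x'))
  s y x' x rx' rx.
have -> : dot (x - xp) (x - xp) = dot (x - x') (x - x')
    + 2 * dot (x' - xp) (x - x') + dot (x' - xp) (x' - xp).
  rewrite (_ : x - xp = (x - x') + (x' - xp)); last by rewrite subrKA.
  by move: (x - x') (x' - xp) => a b; rewrite !dotDl !dotDr (dotC a b); ring.
move=> H; have {}H := H _ _.
have := mulr_ge0 (ltW gamma_gt0) (dot_ge0 (x - x')).
suff : gamma / 2 * dot (x - x') (x - x') <=
  dot v (x - x') + 20 * L * dot (x' - xp) (x - x') + fine (r x) - fine (r x')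
  + gamma / 2 * dot (x - y) (x - y) - gamma / 2 * dot (x' - y) (x' - y) by lra.
apply: H => [w rw|t t01].
  by have := q_min w; rewrite !qE// lee_fin /s; lra.
rewrite /s [x' + _ - xp]addrAC.
move: (x - x') (x' - xp) => a b.
by rewrite !(dotDl, dotDr, dotZl, dotZr) (dotC a b); lra.
Qed.

(** The error [D] is paired with [xp - x'] and [xp - x] separately, since [xp - x] does not depend
    on the fresh draw and its pairing will average to zero. *)
Lemma svrg_prox_descent x (D := v - (grad g xp - dh y)) : edom r x ->
  stage_obj y x' - stage_obj y x <=
  10 * L * dot (xp - x) (xp - x) - 10 * L * dot (x' - x) (x' - x)
  + (38 * L)^-1 * dot D D - dot D (xp - x).
Proof.
move=> rx; have H1 := svrg_prox_optimality rx.
have H2 := favg_upper n_gt0 gs_smooth xp x'.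
have H3 := favg_lower gs_convex gs_smooth xp x.
(* Of the [10 L |x' - xp|^2] given by optimality, the descent lemma spends [L / 2]; the remaining
   [19 L / 2] is what Young's inequality needs. *)
have a0 : 0 < (19 * L)^-1 by rewrite invr_gt0 mulr_gt0.
have := young_dot D (xp - x') a0.
have -> : (19 * L)^-1 / 2 = (38 * L)^-1 by field; rewrite gt_eqF.
have -> : (2 / (19 * L))^-1 = 19 * L / 2 by field; rewrite gt_eqF.
have sq u z : dot (u - z) (u - z) = dot (z - u) (z - u).
  by rewrite -opprB dotNl dotNr opprK.
rewrite /stage_obj (sq xp x') (sq xp x) (sq x' x).
have E u z w : dot u (z - w) = dot u z - dot u w by rewrite dotDr dotNr.
have E' u z w : dot (u - z) w = dot u w - dot z w by rewrite dotDl dotNl.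
have H4 : dot D (xp - x') = dot v xp - dot v x'
    - dot (grad g xp) xp + dot (grad g xp) x' + dot (dh y) xp - dot (dh y) x'.
  by rewrite /D !E' !E; ring.
have H5 : dot D (xp - x) = dot v xp - dot v x
    - dot (grad g xp) xp + dot (grad g xp) x + dot (dh y) xp - dot (dh y) x.
  by rewrite /D !E' !E; ring.
move: H1 H2 H3; rewrite H4 H5 (E v) (E (grad g xp) x') (E (grad g xp) x)
  (E (dh y) x') (E (dh y) x).
lra.
Qed.

End prox_step.


Definition gap y x : R := stage_obj y x - stage_obj y (prox y).

Lemma gap_ge0 y x : edom r x -> 0 <= gap y x.
Proof. by move=> rx; rewrite subr_ge0 prox_point_le. Qed.

Lemma gap_growth y x (u := prox y) : edom r x ->
  gamma / 2 * dot (x - u) (x - u) <= gap y x.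
Proof.
move=> rx; have := stage_obj_growth y rx.
by have := favg_lower gs_convex gs_smooth u x; rewrite /gap /u; lra.
Qed.

Lemma mean_grad_diff_le y x (u := prox y) : edom r x ->
  mean (fun i => dot (grad (gs i) x - grad (gs i) u) (grad (gs i) x - grad (gs i) u))
  <= 2 * L * gap y x.
Proof.
move=> rx; apply: le_trans (favg_cocoercive L_gt0 gs_convex gs_smooth u x) _.
rewrite ler_wpM2l ?mulr_ge0 ?(ltW L_gt0)//.
have := stage_obj_growth y rx; rewrite -/(gap y x) -/u.
by have := mulr_ge0 (ltW gamma_gt0) (dot_ge0 (x - u)); lra.
Qed.

(** * One inner step averaged over the drawn component *)

Section inner_step.
Variables (y xb xp : 'rV[R]_d).
Hypotheses (xb_dom : edom r xb) (xp_dom : edom r xp).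
Let v i := grad (gs i) xp - grad (gs i) xb + (grad g xb - dh y).
Let u := prox y.

(** The error is the centred [A i], so its pairing with [xp - u] averages to zero and its second
    moment is at most that of [A i], which is split through [u]. The constant is
    [4 L / (38 L) = 2 / 19]. *)
Lemma svrg_mean_step :
  mean (fun i => gap y (svrg_prox r gamma eta y (v i) xp)
    + 10 * L * dot (svrg_prox r gamma eta y (v i) xp - u)
                   (svrg_prox r gamma eta y (v i) xp - u))
  <= 10 * L * dot (xp - u) (xp - u) + 2 / 19 * (gap y xp + gap y xb).
Proof.
pose A i := grad (gs i) xp - grad (gs i) xb.
pose m' := n%:R^-1 *: \sum_i A i.
have m'E : m' = grad g xp - grad g xb.
  rewrite !grad_favg; do ?by move=> i; case: (gs_smooth i).
  by rewrite -scalerBr -sumrB.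
have DE i : v i - (grad g xp - dh y) = A i - m'.
  by rewrite m'E /v /A !opprB -addrA subrKA.
apply: (@le_trans _ _ (mean (fun i => 10 * L * dot (xp - u) (xp - u)
    + ((38 * L)^-1 * dot (A i - m') (A i - m') + (-1) * dot (A i - m') (xp - u))))).
  apply: ler_mean => i.
  by have := svrg_prox_descent y (v i) xp (prox_point_dom y); rewrite DE /gap /u; lra.
rewrite meanD mean_cst// lerD2l meanD !meanZ.
have -> : mean (fun i => dot (A i - m') (xp - u)) = 0.
  under [X in mean X]eq_fun do rewrite dotDl dotNl -mulN1r.
  by rewrite meanD meanZ mean_cst// -dot_mean mulN1r subrr.
rewrite mulr0 addr0.
have i0 : 0 <= (38 * L)^-1 by rewrite invr_ge0 mulr_ge0// ltW.
have H : mean (fun i => dot (A i - m') (A i - m')) <= 4 * L * (gap y xp + gap y xb).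
  apply: le_trans (mean_variance_le _ n_gt0) _.
  pose B z i := dot (grad (gs i) z - grad (gs i) u) (grad (gs i) z - grad (gs i) u).
  have Hp : mean (B xp) <= 2 * L * gap y xp := mean_grad_diff_le y xp_dom.
  have Hb : mean (B xb) <= 2 * L * gap y xb := mean_grad_diff_le y xb_dom.
  apply: (@le_trans _ _ (2 * mean (B xp) + 2 * mean (B xb))); last by lra.
  by rewrite -!meanZ -meanD; apply: ler_mean => i; exact: sqdist_le.
apply: le_trans (ler_wpM2l i0 H) _.
have -> : 2 / 19 = (38 * L)^-1 * (4 * L) by field; rewrite gt_eqF.
by rewrite mulrA.
Qed.

End inner_step.


Lemma gap_segment y x z (t : R) : edom r x -> edom r z -> 0 <= t <= 1 ->
  edom r (t *: x + (1 - t) *: z) /\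
  gap y (t *: x + (1 - t) *: z) <= t * gap y x + (1 - t) * gap y z.
Proof.
move=> rx rz t01; have [rw rwle] := edom_segment r_proper r_convex t01 rx rz.
split => //; rewrite /gap /stage_obj.
have : g (t *: x + (1 - t) *: z) <= t * g x + (1 - t) * g z.
  rewrite -!meanZ -meanD; apply: ler_mean => i.
  by apply: convexP t01.
have -> : t *: x + (1 - t) *: z - y = t *: (x - y) + (1 - t) *: (z - y).
  by rewrite !scalerBr [RHS]addrACA -opprD -(scalerDl y) [t + _]addrC subrK scale1r.
have [t0 t1] := andP t01.
have H1 : 0 <= t * (1 - t) by rewrite mulr_ge0// subr_ge0.
have := mulr_ge0 (ltW gamma_gt0) (mulr_ge0 H1 (dot_ge0 ((x - y) - (z - y)))).
move: (x - y) (z - y) => p q.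
rewrite !(dotDl, dotDr, dotNl, dotNr, dotZl, dotZr) (dotC q p).
by move: rwle; lra.
Qed.

(** * One outer loop: the inner iterates and their average *)

Section epoch.
Variables (y xb : 'rV[R]_d).
Hypothesis xb_dom : edom r xb.
Local Notation inner := (svrg_inner gs r dh gamma eta y xb).
Let u := prox y.

Lemma svrg_inner_dom it t : edom r (inner it t).
Proof. by case: t => //= t; exact: svrg_prox_dom. Qed.

(** Causality: later draws can be averaged without moving this iterate. *)
Lemma eq_svrg_inner it it' t : (forall s, (1 <= s <= t)%N -> it s = it' s) ->
  inner it t = inner it' t.
Proof.
elim: t => [|t IH] H; first by [].
rewrite /= IH => [|s /andP[s1 st]]; last by rewrite H// s1 leqW.
by rewrite H ?ltnS ?leqnn.
Qed.

Variables (k s : nat).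
Local Notation draw := (nat * nat * nat)%type.
Implicit Types a : draw -> 'I_n.

Definition epoch_draws T : seq draw := [seq (k, s, t) | t <- iota 1 T].

(** Reads only the draws labelled [(k, s)] of a table shared by the whole run. *)
Definition epoch_iter a t := inner (fun t => a (k, s, t)) t.
Local Notation X := epoch_iter.

Lemma epoch_iterS a t : X a t.+1 = svrg_prox r gamma eta y
  (grad (gs (a (k, s, t.+1))) (X a t) - grad (gs (a (k, s, t.+1))) xb
    + (grad g xb - dh y)) (X a t).
Proof. by []. Qed.

Lemma epoch_iter_dom a t : edom r (X a t).
Proof. exact: svrg_inner_dom. Qed.

Lemma epoch_iter_upd a T j i : (j <= T)%N -> X (upd a (k, s, T.+1) i) j = X a j.
Proof.
move=> jT; apply: eq_svrg_inner => l /andP[_ lj]; rewrite /upd ifN_eq//.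
by apply/negP => /eqP[] E; move: (leq_trans lj jT); rewrite E ltnn.
Qed.

(* Potential of the inner loop: one step increases its mean by at most
   [2/19 * gap y xb]. *)
Let V t a : R := 17 / 19 * \sum_(1 <= j < t.+1) gap y (X a j)
  + 2 / 19 * gap y (X a t) + 10 * L * dot (X a t - u) (X a t - u).

Lemma inner_potential T a : iter_mean (epoch_draws T) (V T) a <=
  2 / 19 * T.+1%:R * gap y xb + 10 * L * dot (xb - u) (xb - u).
Proof.
elim: T => [|T IH].
  (* The start at the snapshot already costs [2/19 * gap y xb], whence [T.+1] in the bound. *)
  by rewrite /= /V big_geq// mulr0 add0r mulr1.
rewrite /epoch_draws -[in iota _ _](addn1 T) iotaD map_cat iter_mean_cat /= add1n.
apply: le_trans
  (ler_iter_mean (Psi := fun a => V T a + 2 / 19 * gap y xb) _) _; last first.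
  rewrite iter_meanD iter_mean_cst//; move: IH; rewrite /epoch_draws.
  rewrite -[T.+2]addn1 natrD; lra.
move=> a' _.
pose v i := grad (gs i) (X a' T) - grad (gs i) xb + (grad g xb - dh y).
pose x' i := svrg_prox r gamma eta y (v i) (X a' T).
have XS i : X (upd a' (k, s, T.+1) i) T.+1 = x' i.
  by rewrite epoch_iterS (epoch_iter_upd a' i (leqnn T)) upd_same.
have -> : (fun i => V T.+1 (upd a' (k, s, T.+1) i)) =
    (fun i => 17 / 19 * \sum_(1 <= j < T.+1) gap y (X a' j)
      + (gap y (x' i) + 10 * L * dot (x' i - u) (x' i - u))).
  (* The new point gets weight [17/19] from the sum and [2/19] from the last-iterate term, in total
     the 1 of [svrg_mean_step]. *)
  apply/funext => i; rewrite /V (big_nat_recr T.+1) ?XS; last by [].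
  under eq_big_nat => j /andP[_ jT] do rewrite (@epoch_iter_upd a' T j i jT).
  rewrite /=; lra.
rewrite meanD mean_cst//.
have := svrg_mean_step y xb_dom (epoch_iter_dom a' T).
by rewrite -/v -/u /V; lra.
Qed.

Definition epoch_avg T a := T%:R^-1 *: \sum_(1 <= t < T.+1) X a t.

Lemma epoch_avg_dom T a : (0 < T)%N -> edom r (epoch_avg T a).
Proof.
move=> T0; apply: (proj1 (jensen_average (phi := gap y) _ _ T0)).
  by move=> x z t; exact: gap_segment.
exact: epoch_iter_dom.
Qed.

(** After Jensen, [T >= 2] gives [2/19 (T + 1) / T <= 3/19], and [200 L <= T gamma] with
    [gap_growth] bounds [10 L |xb - u|^2 / T] by a tenth of the gap; [19/17 (3/19 + 1/10) < 1/2]. *)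
Lemma epoch_contraction T a : Num.max 2 (200 * L / gamma) <= T%:R ->
  iter_mean (epoch_draws T) (fun a => gap y (epoch_avg T a)) a <= 2^-1 * gap y xb.
Proof.
rewrite ge_max ler_pdivrMr// => /andP[T2 Tg].
have T0 : (0 < T)%N by rewrite -(ltr0n R); lra.
have Ti : 0 < T%:R^-1 :> R by rewrite invr_gt0 ltr0n.
apply: le_trans (ler_iter_mean (Psi := fun a => T%:R^-1 * (19 / 17) * V T a) _) _.
  move=> a' _.
  have [_] := jensen_average (phi := gap y) (x := X a')
    (fun x z t rx rz => @gap_segment y x z t rx rz)
    (epoch_iter_dom a') T0.
  move=> /le_trans; apply; rewrite -mulrA ler_wpM2l ?(ltW Ti)// /V.
  have := gap_ge0 y (epoch_iter_dom a' T).
  have := mulr_ge0 (ltW L_gt0) (dot_ge0 (X a' T - u)); lra.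
rewrite iter_meanZ.
apply: le_trans (ler_wpM2l _ (inner_potential T a)) _.
  by rewrite mulr_ge0// ltW.
rewrite -(mulrA T%:R^-1) ler_pdivrMl ?ltr0n//.
have := gap_growth y xb_dom; rewrite -/u.
have gap0 := gap_ge0 y xb_dom.
have := ler_wpM2r (dot_ge0 (xb - u)) Tg; have := ler_wpM2r gap0 T2.
move: (dot _ _) (gap y xb) gap0 => N q q0 H1 H2 H3.
have : 0 <= T%:R * (q - gamma / 2 * N) by rewrite mulr_ge0 ?ler0n// subr_ge0.
rewrite -[T.+1]addn1 natrD; lra.
Qed.

End epoch.

(** * One stage: successive outer loops around a fixed centre *)

Section stage_run.
Variables (y : 'rV[R]_d) (k T : nat).
Hypotheses (y_dom : edom r y) (T_large : Num.max 2 (200 * L / gamma) <= T%:R).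
Local Notation draw := (nat * nat * nat)%type.
Implicit Types a : draw -> 'I_n.

Definition svrg_iter a s := svrg gs r dh gamma eta y T (fun s t => a (k, s, t)) s.

Lemma svrg_iterS a s :
  svrg_iter a s.+1 = epoch_avg y (svrg_iter a s) k s.+1 T a.
Proof. by []. Qed.

Lemma svrg_iter_dom a s : edom r (svrg_iter a s).
Proof.
elim: s => [|s IH]; first exact: y_dom.
rewrite svrg_iterS; apply: epoch_avg_dom => //.
rewrite -(ltr0n R); apply: lt_le_trans T_large.
by rewrite lt_max ltr0n.
Qed.

Lemma eq_epoch_avg xb s a a' :
  (forall t, (1 <= t <= T)%N -> a (k, s, t) = a' (k, s, t)) ->
  epoch_avg y xb k s T a = epoch_avg y xb k s T a'.
Proof.
move=> H; congr (_ *: _); apply: eq_big_nat => t /andP[_ tT].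
apply: eq_svrg_inner => j /andP[j1 jt]; apply: H.
by rewrite j1 (leq_trans jt).
Qed.

Lemma eq_svrg_iter a a' S : (forall s t, (1 <= s <= S)%N -> (1 <= t <= T)%N ->
  a (k, s, t) = a' (k, s, t)) -> svrg_iter a S = svrg_iter a' S.
Proof.
elim: S => [|S IH] H; first by [].
rewrite !svrg_iterS IH => [|s t /andP[s1 sS] tT]; last by rewrite H ?s1 ?leqW.
by apply: eq_epoch_avg => t tT; rewrite H// leqnn.
Qed.

(** In chronological order, so that the last epoch is averaged innermost. *)
Definition stage_draws S : seq draw := flatten [seq epoch_draws k s T | s <- iota 1 S].

Lemma stage_drawsS S : stage_draws S.+1 = stage_draws S ++ epoch_draws k S.+1 T.
Proof.
by rewrite /stage_draws -[in iota _ _](addn1 S) iotaD map_cat flatten_cat /= cats0.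
Qed.

Lemma stage_contraction S a :
  iter_mean (stage_draws S) (fun a => gap y (svrg_iter a S)) a <= 2^-1 ^+ S * gap y y.
Proof.
elim: S => [|S IH]; first by rewrite /= expr0 mul1r.
rewrite stage_drawsS iter_mean_cat.
apply: le_trans (ler_iter_mean (Psi := fun a => 2^-1 * gap y (svrg_iter a S)) _) _.
  move=> a' _.
  apply: le_trans _ (epoch_contraction y (svrg_iter_dom a' S) k S.+1 a' T_large).
  apply: ler_iter_mean => b Hb; rewrite svrg_iterS.
  (* Changing only draws of epoch [S.+1] leaves the snapshot after [S] epochs unchanged. *)
  rewrite (@eq_svrg_iter b a' S)// => s t /andP[_ sS] _; apply: Hb.
  by apply/mapP => -[j _ [] E _]; rewrite E ltnn in sS.
by rewrite iter_meanZ exprS -mulrA ler_pM2l ?invr_gt0.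
Qed.

Definition obj x : R := g x + fine (r x) - h x.

Lemma stage_obj_self : stage_obj y y = obj y.
Proof. by rewrite /stage_obj /obj subrr dotC !dot0l; lra. Qed.

Lemma obj_le_stage_obj x : obj x <= stage_obj y x.
Proof.
have := dh_subgradient y x; have := mulr_ge0 (ltW gamma_gt0) (dot_ge0 (x - y)).
by rewrite /stage_obj /obj; lra.
Qed.

(** With [c] the minimum of the subproblem, [obj] is at most [gap y + c], with equality at [y]; the
    contraction of the gap does the rest. *)
Lemma stage_descent S a :
  iter_mean (stage_draws S) (fun a => obj (svrg_iter a S)) a
  <= obj y - (1 - 2^-1 ^+ S) * gap y y.
Proof.
pose c := stage_obj y (prox y).
apply: (@le_trans _ _ (iter_mean (stage_draws S) (fun a => gap y (svrg_iter a S) + c) a)).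
  apply: ler_iter_mean => b _; rewrite /gap subrK; exact: obj_le_stage_obj.
rewrite iter_meanD iter_mean_cst//.
have := stage_contraction S a; rewrite -stage_obj_self {3}/gap /c.
have -> : gap y y = stage_obj y y - stage_obj y (prox y) by [].
lra.
Qed.

End stage_run.

(** * The whole run: conditioning on the previous stages *)

Section run.
Variables (T S : nat -> nat) (x1 : 'rV[R]_d) (K : nat).
Hypothesis x1_dom : edom r x1.
Hypothesis T_large :
  forall k, (1 <= k <= K)%N -> Num.max 2 (200 * L / gamma) <= (T k)%:R.
Local Notation draw := (nat * nat * nat)%type.
Implicit Types a : draw -> 'I_n.

Definition run_iter a k :=
  stagewise gs r dh gamma eta T S (fun k s t => a (k, s, t)) x1 k.

Lemma run_iterS a k :
  run_iter a k.+1 = svrg_iter (run_iter a k) k.+1 (T k.+1) a (S k.+1).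
Proof. by []. Qed.

Lemma run_iter_dom a k : (k <= K)%N -> edom r (run_iter a k).
Proof.
elim: k => [|k IH] kK; first exact: x1_dom.
by rewrite run_iterS; apply: svrg_iter_dom; [apply: IH; exact: ltnW | exact: T_large].
Qed.

Lemma eq_run_iter a a' k : (forall k' s t, (1 <= k' <= k)%N -> (1 <= s <= S k')%N ->
  (1 <= t <= T k')%N -> a (k', s, t) = a' (k', s, t)) -> run_iter a k = run_iter a' k.
Proof.
elim: k => [|k IH] H; first by [].
rewrite !run_iterS IH => [|k' s t /andP[k1 kk] sS tT]; last by rewrite H ?k1 ?leqW.
by apply: eq_svrg_iter => s t sS tT; rewrite H ?leqnn.
Qed.

Definition run_draws k : seq draw :=
  flatten [seq stage_draws j (T j) (S j) | j <- iota 1 k].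

Lemma run_drawsS k :
  run_draws k.+1 = run_draws k ++ stage_draws k.+1 (T k.+1) (S k.+1).
Proof.
by rewrite /run_draws -[in iota _ _](addn1 k) iotaD map_cat flatten_cat /= cats0.
Qed.

Lemma mem_stage_draws k T' S' j : (j \in stage_draws k T' S') =
  [&& j.1.1 == k, (1 <= j.1.2 <= S')%N & (1 <= j.2 <= T')%N].
Proof.
apply/flattenP/and3P => [[_ /mapP[s sS ->] /mapP[t tT ->]] /=|].
  by move: sS tT; rewrite !mem_iota !add1n !ltnS eqxx.
case: j => [[k' s] t] /= [/eqP -> sS tT].
exists (epoch_draws k s T'); first by apply: map_f; rewrite mem_iota add1n ltnS.
by apply: map_f; rewrite mem_iota add1n ltnS.
Qed.

Lemma mem_run_draws k j : (j \in run_draws k) =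
  [&& (1 <= j.1.1 <= k)%N, (1 <= j.1.2 <= S j.1.1)%N & (1 <= j.2 <= T j.1.1)%N].
Proof.
apply/flattenP/idP => [[_ /mapP[i ik ->]]|].
  rewrite mem_stage_draws => /and3P[/eqP -> -> ->].
  by move: ik; rewrite mem_iota add1n ltnS => ->.
move=> /and3P[kk sS tT]; exists (stage_draws j.1.1 (T j.1.1) (S j.1.1)).
  by apply/mapP; exists j.1.1 => //; rewrite mem_iota add1n ltnS.
by rewrite mem_stage_draws eqxx sS tT.
Qed.

Lemma uniq_run_draws k : uniq (run_draws k).
Proof.
have ue k' s t : uniq (epoch_draws k' s t).
  by rewrite map_inj_uniq ?iota_uniq// => u v [].
have us k' t s : uniq (stage_draws k' t s).
  elim: s => // s IH; rewrite stage_drawsS cat_uniq IH ue andbT /=.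
  apply/hasPn => _ /mapP[u _ ->]; rewrite mem_stage_draws /= ltnn.
  by rewrite !andbF.
elim: k => // k IH; rewrite run_drawsS cat_uniq IH us andbT /=.
apply/hasPn => j; rewrite mem_stage_draws mem_run_draws => /and3P[/eqP -> _ _].
by rewrite ltnn !andbF.
Qed.

(** Given the draws of the first [k] stages, the next centre is fixed, so [stage_descent] applies
    under the outer mean. *)
Lemma run_descent k a : (k < K)%N ->
  iter_mean (run_draws k.+1) (fun a => obj (run_iter a k.+1)) a <=
  iter_mean (run_draws k) (fun a => obj (run_iter a k)) a
  - (1 - 2^-1 ^+ S k.+1) *
    iter_mean (run_draws k) (fun a => gap (run_iter a k) (run_iter a k)) a.
Proof.
move=> kK; rewrite run_drawsS iter_mean_cat -mulNr -iter_meanZ -iter_meanD.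
apply: ler_iter_mean => a' _; rewrite mulNr.
have TL := @T_large k.+1 kK.
apply: le_trans _ (stage_descent k.+1 (run_iter_dom a' (ltnW kK)) TL (S k.+1) a').
apply: ler_iter_mean => b Hb; rewrite run_iterS.
rewrite (@eq_run_iter b a' k)// => k' s t /andP[_ k'k] _ _; apply: Hb.
by rewrite mem_stage_draws /= ltn_eqF// ltnS.
Qed.

Lemma sqr_prox_grad_le y : edom r y ->
  enorm (prox_grad g h r dh gamma y) ^+ 2 <= 2 * gamma * gap y y.
Proof.
move=> ry; rewrite /prox_grad sqr_enorm dotZl dotZr.
have := gap_growth y ry; rewrite -(ler_pM2l gamma_gt0); lra.
Qed.

(** Serves the first stage: [ceil_log2] of 1 is 0, so no outer loop runs there and descent says
    nothing about its gap. *)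
Lemma gap_le_obj y : edom r y -> gap y y <= obj y - m.
Proof.
move=> ry; rewrite /gap stage_obj_self lerD2l lerN2.
by apply: le_trans (F_ge (prox_point_dom y)) _; exact: obj_le_stage_obj.
Qed.

End run.

End stage.

(** * Weighted telescoping *)

Lemma half_exp_ceil_log2 {R : realType} k : (0 < k)%N ->
  2^-1 ^+ ceil_log2 R k <= k%:R^-1 :> R.
Proof.
move=> k0; have kR : 0 < k%:R :> R by rewrite ltr0n.
have l2 : 0 < ln 2 :> R by rewrite ln_gt0// ltr1n.
rewrite exprVn lef_pV2 ?posrE ?exprn_gt0// -ler_ln ?posrE ?exprn_gt0//.
rewrite lnXn// -(mulr_natr (ln 2)) (mulrC (ln 2)) -ler_pdivrMr//.
apply: le_trans (ceil_ge _) _; rewrite /ceil_log2 natr_absz ler_int.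
exact: ler_norm.
Qed.

(** Indices are shifted: [f k], [D k] and [c k] belong to stage [k + 1]. As [c 0] may vanish, [D 0]
    is bounded directly; later [D k] are at most [2 (f k - f k.+1)]. *)
Lemma telescoping_weighted_sum {R : realFieldType} (c f D w : nat -> R) (m Delta : R) K :
  (forall k, (k < K)%N -> f k.+1 <= f k - c k * D k) ->
  (forall k, 0 <= c k) -> (forall k, 2^-1 <= c k.+1) ->
  (forall k, (k < K)%N -> 0 <= D k) ->
  (forall k, (k <= K)%N -> m <= f k) ->
  D 0%N <= Delta -> f 0%N - m <= Delta ->
  (forall k, 0 <= w k) -> (forall k, w k <= w k.+1) -> (0 < K)%N ->
  \sum_(k < K) w k.+1 * D k <= 3 * Delta * w K.
Proof.
move=> desc c0 half D0 fm D0D f0D w0 wS K0.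
have fD k : (k <= K)%N -> f k - m <= Delta.
  elim: k => [//|k IH] kK; have := IH (ltnW kK).
  have := desc _ kK; have := mulr_ge0 (c0 k) (D0 _ kK); lra.
(* Abel summation as an invariant: the reserve [2 w (f - m)] pays for the next difference. The 3 is
   1 for [D 0] plus 2 for [f 1 - m]. *)
suff H k : (k < K)%N ->
    \sum_(j < k.+1) w j.+1 * D j <= 3 * Delta * w k.+1 - 2 * w k.+1 * (f k.+1 - m).
  case: K K0 fm H {desc D0 fD} => // K _ fm /(_ K (leqnn _)) /le_trans; apply.
  have : 0 <= w K.+1 * (f K.+1 - m) by rewrite mulr_ge0// subr_ge0 fm.
  by lra.
elim: k => [|k IH] kK.
  rewrite big_ord_recl big_ord0 addr0 /=.
  have := ler_wpM2l (w0 1%N) D0D; have := ler_wpM2l (w0 1%N) (fD 1%N kK); lra.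
rewrite big_ord_recr/=; have := IH (ltnW kK).
have H1 : D k.+1 <= 2 * (f k.+1 - f k.+2).
  have := desc _ kK; have := ler_wpM2r (D0 _ kK) (half k); lra.
have := ler_wpM2l (w0 k.+2) H1.
(* Growth of the weights is charged to [f k.+1 - m <= Delta]. *)
have := mulr_ge0 (_ : 0 <= w k.+2 - w k.+1) (_ : 0 <= Delta - (f k.+1 - m)).
rewrite !subr_ge0 wS fD 1?ltnW// => /(_ isT isT).
have := mulr_ge0 (_ : 0 <= w k.+2 - w k.+1) (_ : 0 <= Delta).
rewrite subr_ge0 wS (le_trans _ f0D) ?subr_ge0 ?fm// => /(_ isT isT).
lra.
Qed.

(** Discrete form of comparing the sum with the integral of [x^alpha]; the induction step amounts to
    [(K - alpha) (K + 1)^alpha <= K^(alpha + 1)]. *)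
Lemma sum_powR_ge {R : realType} (alpha : R) K : 0 <= alpha ->
  K%:R * K%:R `^ alpha <= (alpha + 1) * \sum_(1 <= j < K.+1) j%:R `^ alpha.
Proof.
move=> a0; elim: K => [|K IH]; first by rewrite mul0r big_geq// mulr0.
rewrite big_nat_recr//= mulrDr -lerBlDr; apply: le_trans IH.
have -> : K.+1%:R = K%:R + 1 :> R by rewrite -natr1.
have [->|K0] := posnP K.
  rewrite add0r powR1; lra.
have KR : 0 < K%:R :> R by rewrite ltr0n.
have K1R : 0 < K%:R + 1 :> R by rewrite ltr_wpDl.
(* [(K / (K + 1))^alpha] as an exponential, bounded below by [1 - alpha / K] through
   [1 + x <= exp x] and [ln (1 + x) <= x]. *)
have -> : K%:R `^ alpha =
    (K%:R + 1) `^ alpha * expR (- (alpha * ln (1 + K%:R^-1))) :> R.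
  have -> : 1 + K%:R^-1 = (K%:R + 1) / K%:R :> R by field; rewrite gt_eqF.
  rewrite /powR !gt_eqF// -expRD ln_div ?posrE//; congr expR; ring.
have Ki : K%:R * (1 - alpha / K%:R) = K%:R - alpha :> R by field; rewrite gt_eqF.
have : 1 - alpha / K%:R <= expR (- (alpha * ln (1 + K%:R^-1))).
  apply: le_trans (expR_ge1Dx _); rewrite lerD2l lerN2 ler_wpM2l//.
  by apply: le_ln1Dx; rewrite (lt_trans _ (_ : 0 < _)) ?invr_gt0// ltrN10.
move=> /(ler_wpM2l (ltW KR)); rewrite Ki.
have := powR_ge0 (K%:R + 1) alpha; move: (powR _ _) (expR _) => p e p0 H.
have := ler_wpM2r p0 H; lra.
Qed.

(** * Sampling *)

Section sampling.
Local Open Scope ereal_scope.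
Context {R : realType} {dO : measure_display} {Omega : measurableType dO}.
Variables (P : probability Omega R) (n K : nat) (D : pred (nat * nat * nat)).
Variables (idx : nat -> nat -> nat -> Omega -> 'I_n) (tau : Omega -> nat).
Variable p : nat -> R.
Hypothesis smp : sampling P K D idx tau p.
Local Notation draw := (nat * nat * nat)%type.
Implicit Types (w : Omega) (b : draw -> 'I_n) (J : seq draw).

Definition drawn w : draw -> 'I_n := fun j => idx j.1.1 j.1.2 j.2 w.

Definition cylinder m J b : set Omega :=
  [set w | tau w = m] `&` [set w | forall j, j \in J -> drawn w j = b j].

Lemma cylinder_cons m j J b i : j \notin J ->
  cylinder m (j :: J) (upd b j i) = cylinder m J b `&` [set w | drawn w j = i].
Proof.
move=> jJ; apply/seteqP; split => w /= [].
  move=> tw H; split; last by rewrite H ?mem_head// upd_same.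
  split=> // k kJ; rewrite H ?inE ?kJ ?orbT// /upd ifN//.
  by apply: contraNneq jJ => <-.
move=> [tw H] ji; split => // k; rewrite inE /upd.
by case: eqVneq => [->//|_ /= kJ]; exact: H.
Qed.

Lemma measurable_cylinder m J b : all D J -> measurable (cylinder m J b).
Proof.
move=> DJ; apply: measurableI; first exact: (measurable_tau smp).
elim: J DJ => [_|j J IH /= /andP[Dj DJ]].
  by rewrite (_ : [set _ | _] = setT)//; apply/seteqP; split.
rewrite (_ : [set _ | _] = [set w | drawn w j = b j]
    `&` [set w | forall j, j \in J -> drawn w j = b j]).
  apply: measurableI; last exact: IH.
  exact: (measurable_idx smp (j := j) (b j) Dj).
apply/seteqP; split => w /=.
  by move=> H; split => [|k kJ]; apply: H; rewrite inE ?eqxx// kJ orbT.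
by move=> [H1 H2] k; rewrite inE => /orP[/eqP ->//|]; exact: H2.
Qed.

Lemma cylinder_prob m J b : (1 <= m <= K)%N -> uniq J -> all D J ->
  P (cylinder m J b) = (p m * n%:R^-1 ^+ size J)%:E.
Proof.
move=> mK uJ DJ; rewrite /cylinder (idx_tau_indep smp b m uJ DJ).
rewrite (tau_law smp mK) EFinM; congr (_ * _).
elim: J DJ {uJ} => [_|j J IH /= /andP[Dj DJ]]; first by rewrite big_nil expr0.
by rewrite big_cons (idx_uniform smp) // IH// exprS EFinM.
Qed.

Definition restricted m J b (Phi : (draw -> 'I_n) -> R) : Omega -> \bar R :=
  fun w => (\1_(cylinder m J b) w * Phi (drawn w))%:E.

(* Conditioning on the draws one at a time: on a cylinder fixing the draws in
   [J0], the remaining ones are independent and uniform. *)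
Lemma integral_cylinder m J J0 b (Phi : (draw -> 'I_n) -> R) : (0 < n)%N ->
    (1 <= m <= K)%N -> uniq (J ++ J0) -> all D (J ++ J0) ->
    (forall a, 0 <= Phi a)%R ->
    (forall a a', (forall j, j \in J ++ J0 -> a j = a' j) -> Phi a = Phi a') ->
  measurable_fun setT (restricted m J0 b Phi) /\
  \int[P]_w (restricted m J0 b Phi w) =
    (p m * n%:R^-1 ^+ size J0 * iter_mean J Phi b)%:E.
Proof.
move=> n0 mK; elim: J J0 b => [|j J IH] J0 b.
  move=> uJ DJ Phi0 PhiE.
  (* All relevant draws are fixed, so [Phi] is constant on the cylinder. *)
  have -> : restricted m J0 b Phi = (fun w => (Phi b)%:E * (\1_(cylinder m J0 b) w)%:E).
    apply/funext => w; rewrite /restricted -EFinM mulrC indicE.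
    have [wE|_] := boolP (w \in cylinder m J0 b); last by rewrite !mulr0.
    rewrite !mulr1; congr (_%:E); apply: PhiE => k kJ.
    by move: wE; rewrite inE => -[_]; exact.
  have mE := measurable_cylinder m b DJ.
  have mI : measurable_fun setT (EFin \o \1_(cylinder m J0 b) : Omega -> \bar R).
    by apply/measurable_EFinP; exact: measurable_indic.
  split; first exact: measurable_funeM.
  rewrite ge0_integralZl//; last by rewrite lee_fin.
  transitivity ((Phi b)%:E * P (cylinder m J0 b)).
    by congr (_ * _); rewrite integral_indic// setIT.
  by rewrite (cylinder_prob b mK uJ DJ) -EFinM mulrC.
rewrite /= => /andP[jJJ0 uJJ0] /andP[Dj DJJ0] Phi0 PhiE.
have jJ0 : j \notin J0 by apply: contra jJJ0; rewrite mem_cat => ->; rewrite orbT.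
have perm : perm_eq (J ++ j :: J0) (j :: J ++ J0).
  exact: (permEl (perm_catCA J [:: j] J0)).
pose F i := restricted m (j :: J0) (upd b j i) Phi.
have H i : measurable_fun setT (F i) /\
    \int[P]_w F i w =
    (p m * n%:R^-1 ^+ size (j :: J0) * iter_mean J Phi (upd b j i))%:E.
  apply: IH => [|||a a' aa'] //.
  - by rewrite (perm_uniq perm) /= jJJ0.
  - by rewrite (perm_all _ perm) /= Dj.
  - by apply: PhiE => k kJ; apply: aa'; rewrite (perm_mem perm).
(* The cylinder is split by the value of draw [j]; at each outcome a single summand survives. *)
have -> : restricted m J0 b Phi = (fun w => \sum_(i <- enum 'I_n) F i w).
  apply/funext => w; rewrite /F /restricted sumEFin -mulr_suml; congr (_ * _)%:E.
  rewrite big_enum /= (bigD1 (drawn w j))//= big1 ?addr0 => [|i ij].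
    by rewrite cylinder_cons// indicI /= [X in (_ * X)%R]indicE mem_set// mulr1.
  rewrite cylinder_cons// indicI /= [X in (_ * X)%R]indicE memNset ?mulr0//=.
  by move=> E; rewrite E eqxx in ij.
split; first by apply: emeasurable_sum => i; exact: (H i).1.
rewrite ge0_integral_sum//; last 2 first.
- by move=> i; exact: (H i).1.
- by move=> i w _; rewrite lee_fin mulr_ge0.
under eq_bigr do rewrite (H _).2.
rewrite sumEFin; congr (_%:E); rewrite -mulr_sumr big_enum /= exprS /mean.
ring.
Qed.


(** Splits over the values of [tau], then averages over the draws that [G] reads; [b] only fills the
    other entries. *)
Lemma expectation_sampling (J : nat -> seq draw) (G : nat -> (draw -> 'I_n) -> R) b :
    (0 < n)%N -> (forall m a, 0 <= G m a)%R ->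
    (forall k, (k < K)%N -> uniq (J k) /\ all D (J k)) ->
    (forall k a a', (forall j, j \in J k -> a j = a' j) -> G k.+1 a = G k.+1 a') ->
  'E_P[fun w => G (tau w) (drawn w)] =
    (\sum_(k < K) p k.+1 * iter_mean (J k) (G k.+1) b)%:E.
Proof.
move=> n0 G0 JD GE; pose F (k : 'I_K) := restricted k.+1 [::] b (G k.+1).
have H (k : 'I_K) : measurable_fun setT (F k) /\
    \int[P]_w F k w = (p k.+1 * iter_mean (J k) (G k.+1) b)%:E.
  have [uJ DJ] := JD k (ltn_ord k).
  have [] := @integral_cylinder k.+1 (J k) [::] b (G k.+1) n0.
  - exact: ltn_ord.
  - by rewrite cats0.
  - by rewrite cats0.
  - by move=> a; exact: G0.
  - by move=> a a' aa'; apply: GE => j jJ; apply: aa'; rewrite cats0.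
  by rewrite expr0 mulr1.
rewrite unlock; transitivity (\int[P]_w \sum_(k <- enum 'I_K) F k w).
  apply: eq_integral => w _; rewrite sumEFin; congr (_%:E); rewrite big_enum /=.
  have /andP[t1 tK] := tau_range smp w.
  have tE : (tau w).-1.+1 = tau w by rewrite prednK.
  (* The ordinal [k] stands for the event [tau = k + 1]. *)
  have tK' : ((tau w).-1 < K)%N by rewrite tE.
  rewrite (bigD1 (Ordinal tK'))//= big1 => [|k kt].
    by rewrite addr0 tE indicE mem_set ?mul1r.
  have /= nkt : ~ cylinder k.+1 [::] b w.
    by move=> [/= tk _]; move/eqP: kt; apply; apply/val_inj; rewrite /= tk.
  by rewrite /F /restricted indicE memNset// mul0r.
rewrite ge0_integral_sum//; last 2 first.
- by move=> k; exact: (H k).1.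
- by move=> k w _; rewrite lee_fin mulr_ge0.
by under eq_bigr do rewrite (H _).2; rewrite sumEFin big_enum.
Qed.

End sampling.

Theorem theorem5
  (R : realType) (d n1 n2 : nat) (hn1 : (0 < n1)%N) (hn2 : (0 < n2)%N)
  (gs : 'I_n1 -> 'rV[R]_d -> R) (hs : 'I_n2 -> 'rV[R]_d -> R)
  (r : 'rV[R]_d -> \bar R)
  (g := favg gs) (h := favg hs)
  (g_convex : convex g) (g_lsc : lsc g)
  (h_convex : convex h) (h_lsc : lsc h)
  (r_proper : eproper r) (r_lsc : lower_semicontinuous r) (r_convex : econvex r)
  (dhs : 'I_n2 -> 'rV[R]_d -> 'rV[R]_d) (dh := vavg dhs)
  (dh_subgradient : forall z, subgradient h z (dh z))
  (L gamma Delta alpha : R)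
  (L_gt0 : 0 < L) (gamma_gt0 : 0 < gamma) (Delta_gt0 : 0 < Delta)
  (alpha_ge1 : 1 <= alpha)
  (gs_convex : forall i, convex (gs i))
  (gs_smooth : forall i, L_smooth L (gs i))
  (F := dc_obj g h r)
  (x1 : 'rV[R]_d) (x1_dom : edom r x1)
  (F_x1 : (F x1 - ereal_inf (range F) <= Delta%:E)%E)
  (K : nat) (K_gt0 : (0 < K)%N)
  (eta := 5 / 100 / L) (T : nat -> nat) (S := ceil_log2 R)
  (T_large : forall k, (1 <= k <= K)%N ->
     Num.max 2 (200 * L / gamma) <= (T k)%:R)
  (dO : measure_display) (Omega : measurableType dO) (P : probability Omega R)
  (idx : nat -> nat -> nat -> Omega -> 'I_n1) (tau : Omega -> nat)
  (hsampling : sampling P K (draws K S T) idx tau (power_weight alpha K))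
  (x := fun (k : nat) (w : Omega) =>
     stagewise gs r dh gamma eta T S (fun k' s t => idx k' s t w) x1 k.-1) :
  ('E_P[fun w => (enorm (prox_grad g h r dh gamma (x (tau w) w)) ^+ 2)%R]
   <= (12 * gamma * Delta * (alpha + 1) / K%:R)%:E)%E.
Proof.
have Fx1 : (F x1 \is a fin_num)%E.
  by rewrite /F /dc_obj -(edom_fineK r_proper x1_dom).
have infle z : (ereal_inf (range F) <= F z)%E by apply: ereal_inf_lbound; exists z.
(* The infimum is finite: [-oo] contradicts the bound [Delta], and [+oo] the finite value at
   [x1]. *)
have [m mE] : exists m, ereal_inf (range F) = m%:E.
  exists (fine (ereal_inf (range F))); rewrite fineK// fin_numE.
  apply/andP; split; apply/eqP => E; move: F_x1 (infle x1).
    by rewrite E -(fineK Fx1).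
  by rewrite E -(fineK Fx1).
have objE z : edom r z -> F z = (obj gs h r z)%:E.
  by move=> rz; rewrite /F /dc_obj -(edom_fineK r_proper rz).
have F_ge z : edom r z -> m <= favg gs z + fine (r z) - h z.
  by move=> rz; rewrite -lee_fin -mE -/(obj gs h r z) -(objE z rz).
have obj_x1 : obj gs h r x1 - m <= Delta.
  by move: F_x1; rewrite mE (objE _ x1_dom).
pose X a k := run_iter gs r dh L gamma T S x1 a k.
pose b : nat * nat * nat -> 'I_n1 := fun=> Ordinal hn1.
pose J k := run_draws T S k.
(* The point of stage [m] is reached after [m - 1] stages. *)
pose G m a := enorm (prox_grad g h r dh gamma (X a m.-1)) ^+ 2.
have X_dom a k : (k <= K)%N -> edom r (X a k).
  exact: (run_iter_dom hn1 L_gt0 gamma_gt0 gs_convex gs_smooth r_proper r_lsc r_convex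
    dh_subgradient x1_dom F_ge S x1_dom T_large).
rewrite -[X in expectation P X]/(fun w => G (tau w) (drawn idx w)).
rewrite (@expectation_sampling _ _ _ _ _ _ _ _ _ _ hsampling J G b hn1); last 3 first.
- by move=> k a; rewrite /G exprn_ge0// enorm_ge0.
- move=> k kK; split; first exact: uniq_run_draws.
  apply/allP => j; rewrite mem_run_draws /draws => /and3P[/andP[-> jk] -> ->].
  by rewrite (leq_trans jk (ltnW kK)).
- move=> k a a' aa'; rewrite /G /X /= (@eq_run_iter _ _ _ _ _ _ _ _ T S x1 a a' k)//.
  by move=> k' s t kk ss tt; apply: aa'; rewrite mem_run_draws /= kk ss tt.
rewrite lee_fin.
pose f k := iter_mean (J k) (fun a => obj gs h r (X a k)) b.
pose D k := iter_mean (J k) (fun a => gap gs h r dh gamma (X a k) (X a k)) b.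
pose w k := k%:R `^ alpha : R.
have a0 : 0 <= alpha by exact: le_trans alpha_ge1.
have Sk k : 2^-1 ^+ S k.+1 <= k.+1%:R^-1 :> R by exact: half_exp_ceil_log2.
have tel : \sum_(k < K) w k.+1 * D k <= 3 * Delta * w K.
  apply: (@telescoping_weighted_sum _ (fun k => 1 - 2^-1 ^+ S k.+1) f D w m) => //.
  - move=> k kK; exact: (run_descent hn1 L_gt0 gamma_gt0 gs_convex gs_smooth r_proper
      r_lsc r_convex dh_subgradient x1_dom F_ge S x1_dom T_large b kK).
  - by move=> k; rewrite subr_ge0 (le_trans (Sk k))// invf_le1 ?ltr0n// ler1n.
  (* From the second stage on, [c] is at least [1 - 1/(k + 2) >= 1/2]. *)
  - move=> k; rewrite lerBrDr -lerBrDl (le_trans (Sk k.+1))//.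
    have -> : 1 - 2^-1 = 2^-1 :> R by lra.
    by rewrite lef_pV2 ?posrE// ler_nat.
  - move=> k kK; rewrite -(iter_mean_cst (J k) 0 b hn1); apply: ler_iter_mean => a _.
    exact: (gap_ge0 gamma_gt0 gs_smooth r_proper r_lsc dh_subgradient x1_dom F_ge _
      (X_dom a k (ltnW kK))).
  - move=> k kK; rewrite -(iter_mean_cst (J k) m b hn1); apply: ler_iter_mean => a _.
    exact: F_ge (X_dom a k kK).
  - apply: le_trans obj_x1.
    exact: (gap_le_obj gamma_gt0 gs_smooth r_proper r_lsc dh_subgradient x1_dom
      F_ge x1_dom).
  - by move=> k; exact: powR_ge0.
  - by move=> k; rewrite ge0_ler_powR ?nnegrE// ler_nat.
pose W := \sum_(1 <= j < K.+1) w j.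
have KR : 0 < K%:R :> R by rewrite ltr0n.
have wK : 0 < w K by rewrite powR_gt0.
have WK : K%:R * w K <= (alpha + 1) * W by exact: sum_powR_ge.
have W0 : 0 < W.
  by rewrite -(pmulr_rgt0 _ (_ : 0 < alpha + 1)) ?(lt_le_trans _ WK) ?mulr_gt0//; lra.
apply: (@le_trans _ _ (\sum_(k < K) 2 * gamma / W * (w k.+1 * D k))).
  apply: ler_sum => k _; rewrite /power_weight -/(w k.+1) -/W.
  have -> : 2 * gamma / W * (w k.+1 * D k) = w k.+1 / W * (2 * gamma * D k) by ring.
  rewrite ler_wpM2l ?divr_ge0 ?powR_ge0 ?(ltW W0)// -iter_meanZ.
  apply: ler_iter_mean => a _.
  exact: (sqr_prox_grad_le hn1 gamma_gt0 gs_convex gs_smooth r_proper r_lsc r_convex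
    dh_subgradient x1_dom F_ge (X_dom a k (ltnW (ltn_ord k)))).
rewrite -mulr_sumr.
have c0 : 0 <= 2 * gamma / W by rewrite divr_ge0 ?mulr_ge0 ?(ltW gamma_gt0) ?(ltW W0).
apply: le_trans (ler_wpM2l c0 tel) _.
rewrite ler_pdivlMr//.
(* The factor [2 * 3 = 6] is half of the 12 claimed. *)
have -> : 2 * gamma / W * (3 * Delta * w K) * K%:R =
    6 * (gamma * Delta) * (K%:R * w K) / W by ring.
rewrite ler_pdivrMr//.
have := ler_wpM2l (ltW (mulr_gt0 gamma_gt0 Delta_gt0)) WK.
have := mulr_gt0 (mulr_gt0 gamma_gt0 Delta_gt0) (mulr_gt0 KR wK).
lra.
Qed.
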